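(* The map $\Phi:G\times S_{\mathrm{reg}}\to\mathfrak{g}$, $\Phi(g,x)=-\mathrm{Ad}_{g^{-1}}(x)$, is a morphism of Poisson varieties.
   Context: $G$ is a connected, simply-connected, complex semisimple linear algebraic group of rank $\mathrm{rk}(G)$, with Lie algebra $\mathfrak{g}$, Killing form $\langle\cdot,\cdot\rangle$, and adjoint representation $\mathrm{Ad}$. For $x\in\mathfrak{g}$, $Z_{\mathfrak{g}}(x)=\{y\in\mathfrak{g}:[x,y]=0\}$; $x$ is regular if $\dim Z_{\mathfrak{g}}(x)=\mathrm{rk}(G)$. There is exactly one nilpotent adjoint orbit consisting of regular elements, denoted $\mathcal{O}_{\mathrm{reg}}$. Fix a regular $\mathfrak{sl}_2(\mathbb{C})$-triple $(\xi,h,\eta)$ in $\mathfrak{g}$, i.e. $[\xi,\eta]=h$, $[h,\xi]=2\xi$, $[h,\eta]=-2\eta$ with $\xi,\eta\in\mathcal{O}_{\mathrm{reg}}$. The associated Slodowy slice is $S_{\mathrm{reg}}:=\xi+Z_{\mathfrak{g}}(\eta)\subseteq\mathfrak{g}$. Poisson structure on $\mathfrak{g}$: the canonical Lie–Poisson structure on $\mathfrak{g}^*$, $\{f,k\}(\alpha)=\alpha([d_\alpha f,d_\alpha k])$, transported to $\mathfrak{g}$ via the isomorphism $\mathfrak{g}\to\mathfrak{g}^*$, $x\mapsto\langle x,\cdot\rangle$. Poisson structure on $G\times S_{\mathrm{reg}}$: $G\times\mathfrak{g}$ carries the holomorphic symplectic form $$\omega_{(g,x)}\big((d_eR_g(y_1),z_1),(d_eR_g(y_2),z_2)\big)=\langle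 y_1,z_2\rangle-\langle y_2,z_1\rangle-\langle x,[y_1,y_2]\rangle,\quad y_1,y_2,z_1,z_2\in\mathfrak{g},$$ where $R_g$ is right multiplication by $g$; its restriction to $G\times S_{\mathrm{reg}}$ is symplectic (known, by Bielawski), and induces the Poisson bracket $\{f,k\}=\omega(X_f,X_k)$, where $\omega(X_f,\cdot)=df$. *)

(* Defs.v *)
From HB Require Import structures.
From mathcomp Require Import all_boot all_order all_algebra.
From mathcomp Require Import complex.
From mathcomp Require Import all_classical all_reals all_analysis.
From mathcomp Require mpoly.
(* The notations of multinomials clash with those of MathComp-Analysis. *)
Import -(notations) mpoly.

Set Implicit Arguments.
Unset Strict Implicit.
Unset Printing Implicit Defensive.

Import Order.TTheory GRing.Theory Num.Theory numFieldNormedType.Exports.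
Local Open Scope classical_set_scope.
Local Open Scope ring_scope.

(* R[i], presented through its numClosedFieldType structure so that the
   matrix spaces over it receive their Euclidean topology. *)
Definition Cplx (R : realType) : numClosedFieldType := R[i].

Section AlgebraicGeometry.
Variable K : fieldType.

(* Polynomial functions on a finite-dimensional space V are written in the
   coordinates of the basis [vbasis fullv]; none of the notions below depends
   on that basis. *)
Definition polyOn (V : vectType K) := mpoly (\dim (fullv : {vspace V})) K.

Definition peval (V : vectType K) (p : polyOn V) (x : V) : K :=
  meval (fun i => coord (vbasis fullv) i x) p.

Definition pdiff (V : vectType K) (p : polyOn V) (x v : V) : K :=
  \sum_(i < \dim (fullv : {vspace V}))
    peval (mderiv i p) x * coord (vbasis fullv) i v.

Definition zclosed (V : vectType K) (A : set V) : Prop :=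
  exists P : set (polyOn V), A = [set x | forall p, P p -> peval p x = 0].

Definition zopen (V : vectType K) (A : set V) : Prop := zclosed (~` A).

Definition zconnected (V : vectType K) (A : set V) : Prop :=
  A !=set0 /\
  forall E F : set V, zclosed E -> zclosed F ->
    A `<=` E `|` F -> A `&` E `&` F = set0 -> A `<=` E \/ A `<=` F.

(* The varieties below are locally closed subsets X of finite-dimensional
   spaces. A function f, of which only the values on X matter, is regular
   at x when it equals a quotient pq.1 / pq.2 of polynomials on a Zariski
   neighbourhood of x in X. *)
Definition regular_germ (V : vectType K) (X : set V) (f : V -> K) (x : V)
    (pq : polyOn V * polyOn V) : Prop :=
  exists U : set V, [/\ zopen U, U x &
    forall y, X y -> U y ->
      peval pq.2 y != 0 /\ f y = peval pq.1 y / peval pq.2 y].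

Definition regular_on (V : vectType K) (X U : set V) (f : V -> K) : Prop :=
  forall x, X x -> U x -> exists pq, regular_germ X f x pq.

(* The differential at x of a function regular at x. On vectors v tangent to X
   at x the value does not depend on the chosen fraction; it is only used
   for such v. *)
Definition rdiff (V : vectType K) (X : set V) (f : V -> K) (x v : V) : K :=
  let pq := xget (0, 0) (regular_germ X f x : set (polyOn V * polyOn V)) in
  (peval pq.2 x * pdiff pq.1 x v - peval pq.1 x * pdiff pq.2 x v)
    / peval pq.2 x ^+ 2.

Definition variety_morphism (V W : vectType K) (X : set V) (Y : set W)
    (phi : V -> W) : Prop :=
  (forall x, X x -> Y (phi x)) /\
  forall U : set W, zopen U ->
    (exists2 U' : set V, zopen U' & X `&` phi @^-1` U = X `&` U') /\
    (forall f, regular_on Y U f -> regular_on X (phi @^-1` U) (f \o phi)).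

(* A bracket only looks at germs, so it is written as one operation on functions
   and is meaningful at the points where both arguments are regular. *)
Definition bracket_on (V : vectType K) := (V -> K) -> (V -> K) -> V -> K.

Definition poisson_morphism (V W : vectType K)
    (X : set V) (brX : bracket_on V) (Y : set W) (brY : bracket_on W)
    (phi : V -> W) : Prop :=
  variety_morphism X Y phi /\
  forall (U : set W) (f k : W -> K), zopen U ->
    regular_on Y U f -> regular_on Y U k ->
    forall x, X x -> U (phi x) ->
      brX (f \o phi) (k \o phi) x = brY f k (phi x).

End AlgebraicGeometry.

Section LinearAlgebraicGroup.
Variables (K : fieldType) (n : nat).
Implicit Types G T : set 'M[K]_n.

Definition linear_algebraic_group G : Prop :=
  [/\ G 1%:M,
      forall a b, G a -> G b -> G (a *m b),
      forall a, G a -> G (invmx a) &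
      exists2 Z : set 'M[K]_n, zclosed Z & G = Z `&` [set a | a \in unitmx]].

(* G is closed in the open subset GL_n of M_n, so its tangent space at the
   identity is cut out of M_n by the differentials of the polynomials vanishing
   on G. *)
Definition tangent_at_1 G : set 'M[K]_n :=
  [set a | forall p : polyOn 'M[K]_n,
     (forall g, G g -> peval p g = 0) -> pdiff p 1%:M a = 0].

Definition Lie G : {vspace 'M[K]_n} :=
  xget 0%VS [set L : {vspace 'M[K]_n} | forall a, a \in L <-> tangent_at_1 G a].

Lemma LieP G a : a \in Lie G <-> tangent_at_1 G a.
Proof.
suff [L HL] : exists L : {vspace 'M[K]_n},
    forall a, a \in L <-> tangent_at_1 G a.
  by have := @xgetPex _ 0%VS
    [set L : {vspace 'M[K]_n} | forall a, a \in L <-> tangent_at_1 G a]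
    (ex_intro _ L HL); apply.
have cD : forall k u v, tangent_at_1 G u -> tangent_at_1 G v ->
    tangent_at_1 G (k *: u + v).
  move=> k u v Hu Hv p Hp; rewrite /pdiff.
  under eq_bigr => i _ do rewrite linearP mulrDr /= mulrCA.
  rewrite big_split -mulr_sumr /=.
  by move: (Hu p Hp) (Hv p Hp); rewrite /pdiff => -> ->; rewrite mulr0 addr0.
have c0 : tangent_at_1 G 0.
  by move=> p _; rewrite /pdiff big1 // => i _; rewrite linear0 mulr0.
pose P d := `[< exists L : {vspace 'M[K]_n},
  \dim L = d /\ forall u, u \in L -> tangent_at_1 G u >].
have exP : exists d, P d.
  by exists 0%N; apply/asboolP; exists 0%VS; rewrite dimv0; split=> // u;
    rewrite memv0 => /eqP ->.
have ubP d : P d -> (d <= \dim (fullv : {vspace 'M[K]_n}))%N.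
  by move=> /asboolP[L [<- _]]; apply/dimvS/subvf.
case: (ex_maxnP exP ubP) => d /asboolP[L [dL HL]] maxd.
exists L => u; split=> [/HL//|Hu].
have : P (\dim (L + <[u]>)%VS).
  apply/asboolP; exists (L + <[u]>)%VS; split=> // w.
  case/memv_addP => l /HL Hl [m /vlineP[k ->] ->].
  by rewrite addrC; apply: cD.
move/maxd; rewrite -dL => le.
have /eqP -> : L == (L + <[u]>)%VS by rewrite eqEdim addvSl.
by rewrite (subvP (addvSr _ _)) // memv_line.
Qed.

Definition torus T : Prop :=
  [/\ linear_algebraic_group T, zconnected T &
      exists2 P : 'M[K]_n, P \in unitmx &
        forall t, T t -> is_diag_mx (P *m t *m invmx P)].

(* The common dimension of the maximal tori, i.e. the largest dimension of
   a torus contained in G. *)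
Definition rk G : nat :=
  (\max_(d < (n * n).+1 |
     `[< exists T, [/\ T `<=` G, torus T & \dim (Lie T) = d] >]) d)%N.

End LinearAlgebraicGroup.

Section SimplyConnected.
Variables (R : realType) (n : nat).

(* Euclidean topology: path-connected with trivial fundamental group. *)
Definition simply_connected (A : set 'M[Cplx R]_n) : Prop :=
  (forall a b, A a -> A b -> exists c : R -> 'M[Cplx R]_n,
     [/\ {within `[0, 1], continuous c}, c @` `[0, 1] `<=` A,
         c 0 = a & c 1 = b]) /\
  (forall c : R -> 'M[Cplx R]_n,
     {within `[0, 1], continuous c} -> c @` `[0, 1] `<=` A -> c 0 = c 1 ->
     exists H : R * R -> 'M[Cplx R]_n,
       [/\ {within `[0, 1] `*` `[0, 1], continuous H},
           H @` (`[0, 1] `*` `[0, 1]) `<=` A,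
           forall t, t \in `[0, 1] -> H (0, t) = c t,
           forall t, t \in `[0, 1] -> H (1, t) = c 0 &
           forall s, s \in `[0, 1] -> H (s, 0) = c 0 /\ H (s, 1) = c 0]).

End SimplyConnected.

Section LieAlgebra.
Variables (K : fieldType) (n : nat) (G : set 'M[K]_n).

(* The Lie algebra as a vector space in its own right. *)
Definition lieAlg : vectType K := subvs_of (Lie G).
Local Notation g := lieAlg.

(* [vsproj (Lie G)] retracts M_n onto Lie G; in [brk] and [Ad] it is applied to
   matrices that already lie in Lie G. *)
Definition brk (x y : g) : g :=
  vsproj (Lie G) (vsval x *m vsval y - vsval y *m vsval x).

Definition Ad (a : 'M[K]_n) (x : g) : g :=
  vsproj (Lie G) (a *m vsval x *m invmx a).

Definition ad (x : g) : 'End(g) := linfun (brk x).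

Definition centralizer (x : g) : {vspace g} := lker (ad x).

Definition end_trace (V : vectType K) (u : 'End(V)) : K :=
  \sum_(i < \dim (fullv : {vspace V}))
    coord (vbasis fullv) i (u (vbasis fullv)`_i).

Definition killing (x y : g) : K := end_trace (ad x \o ad y)%VF.

Definition brkv (I J : {vspace g}) : {vspace g} :=
  <<[seq brk x y | x <- vbasis I, y <- vbasis J]>>%VS.

Definition lie_ideal (I : {vspace g}) : Prop :=
  forall x y, y \in I -> brk x y \in I.

Definition lie_solvable (I : {vspace g}) : Prop :=
  exists k, iter k (fun J => brkv J J) I = 0%VS.

(* Trivial radical. A connected linear algebraic group over a field of
   characteristic 0 is called semisimple when its Lie algebra is. *)
Definition lie_semisimple : Prop :=
  forall I : {vspace g}, lie_ideal I -> lie_solvable I -> I = 0%VS.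

Definition regular_elt (x : g) : Prop := \dim (centralizer x) = rk G.

Definition nilpotent_elt (x : g) : Prop :=
  exists k, forall y, iter k (ad x) y = 0.

Definition Ad_orbit (x : g) : set g := [set Ad a x | a in G].

(* The regular nilpotent orbit is unique, so that the union Oreg of all
   such orbits is that orbit. *)
Definition regular_nilpotent_orbit (O : set g) : Prop :=
  (exists x, O = Ad_orbit x) /\
  forall y, O y -> nilpotent_elt y /\ regular_elt y.

Definition Oreg : set g :=
  [set x | exists2 O, regular_nilpotent_orbit O & O x].

Definition regular_sl2_triple (xi h eta : g) : Prop :=
  [/\ brk xi eta = h, brk h xi = 2%:R *: xi, brk h eta = - (2%:R *: eta),
      Oreg xi & Oreg eta].

Definition Slodowy (xi eta : g) : set g :=
  [set xi + z | z in [set z | z \in centralizer eta]].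

Definition dualAlg : vectType K := 'Hom(g, K^o).

(* The differential at alpha of a function on the dual space, seen in g through
   the canonical isomorphism of g with its bidual. *)
Definition dual_diff (f : dualAlg -> K) (alpha : dualAlg) : g :=
  xget 0 [set a : g | forall beta : dualAlg,
    beta a = rdiff setT f alpha beta].

Definition lie_poisson_dual : bracket_on dualAlg := fun f k alpha =>
  alpha (brk (dual_diff f alpha) (dual_diff k alpha)).

Definition kappa : 'Hom(g, dualAlg) :=
  linfun (fun x => linfun (killing x : g -> K^o) : dualAlg).

Definition lie_poisson : bracket_on g := fun f k x =>
  lie_poisson_dual (f \o (kappa^-1)%VF) (k \o (kappa^-1)%VF) (kappa x).

(* A pair w = (y, z) stands for the tangent vector (d_e R_a (y), z) to
   G x g at (a, x); R_a being linear, d_e R_a (y) is the matrix y a. *)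
Definition right_vec (a : 'M[K]_n) (w : (g * g)%type) :
    ('M[K]_n * g)%type := (vsval w.1 *m a, w.2).

Definition omega (ax : ('M[K]_n * g)%type) (w1 w2 : (g * g)%type) : K :=
  killing w1.1 w2.2 - killing w2.1 w1.2 - killing ax.2 (brk w1.1 w2.1).

Section Slice.
Variables xi eta : g.

Definition GxS : set ('M[K]_n * g)%type := G `*` Slodowy xi eta.

(* The pairs (y, z) whose [right_vec] is tangent to G x S at (a, x); the
   condition does not depend on (a, x). *)
Definition tangent_GxS : set (g * g)%type :=
  [set w | w.2 \in centralizer eta].

Definition hamiltonian (f : ('M[K]_n * g)%type -> K)
    (ax : ('M[K]_n * g)%type) : (g * g)%type :=
  xget 0 [set X : (g * g)%type | tangent_GxS X /\
    forall w, tangent_GxS w ->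
      omega ax X w = rdiff GxS f ax (right_vec ax.1 w)].

Definition slice_poisson : bracket_on ('M[K]_n * g)%type :=
  fun f k ax => omega ax (hamiltonian f ax) (hamiltonian k ax).

End Slice.

Definition Phi (ax : ('M[K]_n * g)%type) : g := - Ad (invmx ax.1) ax.2.

End LieAlgebra.

(* Main.v *)
(* For f regular near Phi(a,x), let u be the Killing gradient of f at Phi(a,x).
   On tangent vectors (y a, z) the differential of Phi is
   -Ad_{a^-1} (z + [x, y]), so that d(f o Phi) sends (y a, z) to
   -<Ad_a u, z + [x, y]>. This is omega((-Ad_a u, 0), (y, z)) by invariance of
   the Killing form, and (-Ad_a u, 0) is tangent to G x S because its second
   component vanishes; hence it is a Hamiltonian vector of f o Phi and
   {f o Phi, k o Phi} = -<x, [Ad_a u, Ad_a v]> = <Phi, [u, v]>.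
   Since omega is antisymmetric, the bracket does not depend on the choice of
   Hamiltonian vectors.

   Gradients exist because the Killing form is nondegenerate (Cartan's
   criterion). Let I be its radical and x in [I, I]. The endomorphism Y acting
   as the complex conjugate of lambda on the generalized eigenspace of ad x for
   lambda is a derivation, so tr (ad x o Y) = 0; this trace is the sum of the
   |lambda|^2, hence ad x is nilpotent, and Engel's theorem makes I solvable. *)
From HB Require Import structures.
Require Import Defs.
From mathcomp Require Import all_boot all_order all_algebra perm ring.
From mathcomp Require Import all_classical all_reals.
From mathcomp Require mpoly.
Import -(notations) mpoly.

Set Implicit Arguments.
Unset Strict Implicit.
Unset Printing Implicit Defensive.

Import Order.TTheory GRing.Theory Num.Theory passmx.
Local Open Scope ring_scope.

(** * The conjugate of the semisimple part *)

Section ConjugatePart.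
Variable C : numClosedFieldType.
Implicit Types (s : seq C) (p q : {poly C}).

Lemma coprimep_prod_exp_XsubC s (d k : nat) (a : C) : a \notin s ->
  coprimep (('X - a%:P) ^+ k) (\prod_(b <- s) ('X - b%:P) ^+ d).
Proof.
elim: s => [|b s IH]; first by rewrite big_nil coprimep1.
rewrite inE negb_or big_cons coprimepMr => /andP[ab /IH ->]; rewrite andbT.
by rewrite coprimep_expl// coprimep_expr// coprimep_XsubC root_XsubC eq_sym.
Qed.

(** Chinese remainders for the pairwise coprime [('X - a%:P) ^+ d]. In the induction, [v * M] is 1
    modulo the new power and 0 modulo the old ones, so it corrects [q] at [a] only. *)
Lemma poly_interpolation s (d : nat) (f : C -> C) : uniq s ->
  exists q, forall a, a \in s -> ('X - a%:P) ^+ d %| q - (f a)%:P.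
Proof.
elim: s => [|a s IH] /=; first by exists 0.
case/andP=> as_ /IH[q qP].
have /Bezout_eq1_coprimepP[[u v] /= uv] := coprimep_prod_exp_XsubC d d as_.
set M := \prod_(b <- s) _ in uv.
exists (q + v * M * ((f a)%:P - q)) => b; rewrite inE => /orP[/eqP ->|bs].
  have -> : q + v * M * ((f a)%:P - q) - (f a)%:P =
      u * ('X - a%:P) ^+ d * (q - (f a)%:P).
    have -> : v * M = 1 - u * ('X - a%:P) ^+ d by rewrite -uv addrC addKr.
    by ring.
  by rewrite dvdp_mulr// dvdp_mull.
rewrite addrAC dvdp_addr ?qP// dvdp_mulr// dvdp_mull//.
by rewrite /M (big_rem b)//= dvdp_mulr.
Qed.

Lemma horner_mx_trig n (T : 'M[C]_n.+1) q : is_trig_mx T ->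
  is_trig_mx (horner_mx T q) /\ forall i, horner_mx T q i i = q.[T i i].
Proof.
move=> /is_trig_mxP trigT; elim/poly_ind: q => [|q c [/is_trig_mxP IH1 IH2]].
  by rewrite rmorph0 mx0_is_trig; split=> // i; rewrite mxE horner0.
rewrite rmorphD rmorphM /= horner_mx_X horner_mx_C.
split=> [|i].
  apply/is_trig_mxP => i j ij; rewrite !mxE -val_eqE /= (ltn_eqF ij) mulr0n addr0.
  apply: big1 => k _; case: (ltnP i k) => ik; first by rewrite IH1 ?mul0r.
  by rewrite trigT ?mulr0// (leq_ltn_trans ik ij).
rewrite !mxE eqxx mulr1n hornerMXaddC -IH2; congr (_ + _).
rewrite (bigD1 i)//= big1 ?addr0// => k; rewrite -val_eqE /= neq_ltn.
by case/orP=> ki; [rewrite trigT ?mulr0 | rewrite IH1 ?mul0r].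
Qed.

(** No multiplicity exceeds [size s], so one uniform exponent on the distinct roots suffices. *)
Lemma dvdp_prod_undup s :
  \prod_(a <- s) ('X - a%:P) %| \prod_(a <- undup s) ('X - a%:P) ^+ size s.
Proof.
rewrite -(big_undup_iterop_count _ s predT).
apply: (big_rec2 (fun p q => p %| q)) => // a p q _ pq.
by rewrite dvdp_mul// dvdp_exp2l// count_size.
Qed.


Section OneMatrix.
Variables (n : nat) (A : 'M[C]_n.+1).
Implicit Types v : 'rV[C]_n.+1.

Lemma mul_horner_mxM v p q :
  v *m horner_mx A (p * q) = v *m horner_mx A p *m horner_mx A q.
Proof. by rewrite rmorphM -mulmxE mulmxA. Qed.

Lemma horner_mx_dvdp v p q : p %| q ->
  v *m horner_mx A p = 0 -> v *m horner_mx A q = 0.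
Proof. by move=> /dvdpP[r ->] vp; rewrite mulrC mul_horner_mxM vp mul0mx. Qed.

Lemma horner_mx_gcdp v p q : v *m horner_mx A p = 0 ->
  v *m horner_mx A q = 0 -> v *m horner_mx A (gcdp p q) = 0.
Proof.
move=> vp vq; have [[a b] /andP[/= ab _]] := Bezoutp p q.
apply: (horner_mx_dvdp ab); rewrite rmorphD mulmxDr (mulrC a) (mulrC b).
by rewrite !mul_horner_mxM vp vq !mul0mx addr0.
Qed.

Lemma char_poly_split : exists2 s : seq C, size s = n.+1 &
  horner_mx A (\prod_(a <- s) ('X - a%:P)) = 0 /\
  forall q, (forall a, a \in s -> q.[a] = a^* ) ->
    \tr (A *m horner_mx A q) = \sum_(a <- s) `|a| ^+ 2.
Proof.
have [P /unitarymx_unit Pu] := Schur A (ltn0Sn n).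
rewrite /similar_to conjumx//; set T := P *m A *m _ => trigT.
have AT q : P *m horner_mx A q *m invmx P = horner_mx T q.
  by rewrite -horner_mx_uconj.
exists [seq T i i | i <- index_enum (ordinal n.+1)].
  by rewrite size_map [index_enum _]unlock -enumT size_enum_ord.
rewrite !big_map; split.
  have := Cayley_Hamilton T; rewrite char_poly_trig// -AT => /(congr1 (mulmx^~ P)).
  rewrite mulmxKV// mul0mx => /(congr1 (mulmx (invmx P))).
  by rewrite mulKmx// mulmx0 => ->.
move=> q qP.
have [_ Tq] := horner_mx_trig q trigT.
have [_ TXq] := horner_mx_trig ('X * q) trigT.
have -> : A *m horner_mx A q = horner_mx A ('X * q).
  by rewrite rmorphM /= horner_mx_X.
have -> : \tr (horner_mx A ('X * q)) = \tr (horner_mx T ('X * q)).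
  by rewrite -AT mxtrace_mulC mulKmx.
apply: eq_bigr => i _; rewrite TXq hornerM hornerX qP ?normCK//.
by apply/mapP; exists i; rewrite ?mem_index_enum.
Qed.

(** Primary decomposition in the form of an induction principle: every vector is a sum of
    generalized eigenvectors, split off one eigenvalue at a time. *)
Lemma generalized_eigen_ind (P : 'rV[C]_n.+1 -> Prop) :
  (forall u v, P u -> P v -> P (u + v)) ->
  (forall a k v, v *m horner_mx A (('X - a%:P) ^+ k) = 0 -> P v) ->
  forall v, P v.
Proof.
move=> PD Pgen v; have [s _ [s0 _]] := char_poly_split.
have : v *m horner_mx A (\prod_(a <- undup s) ('X - a%:P) ^+ size s) = 0.
  by apply: (horner_mx_dvdp (dvdp_prod_undup s)); rewrite s0 mulmx0.
elim: (undup s) (undup_uniq s) v => [_ v|a r IH /= /andP[ar ur] v].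
  (* The empty product forces [v = 0], a generalized eigenvector with exponent 0 for any scalar. *)
  rewrite big_nil => v0; apply: (Pgen 0 0%N).
  by rewrite expr0.
rewrite big_cons; set p := _ ^+ _; set q := \prod_(_ <- _) _ => v0.
have /Bezout_eq1_coprimepP[[b c] /= bc] :=
  coprimep_prod_exp_XsubC (size s) (size s) ar.
(* By the Bezout identity; the first summand is killed by [p], the second by [q]. *)
have -> : v = v *m horner_mx A (c * q) + v *m horner_mx A (b * p).
  by rewrite -mulmxDr -rmorphD addrC bc rmorph1 mulmx1.
apply: PD; [apply: (Pgen a (size s))|apply: IH => //];
  rewrite -mul_horner_mxM; apply: horner_mx_dvdp v0.
  by rewrite -mulrA (mulrC q) dvdp_mull.
by rewrite -mulrA dvdp_mull.
Qed.

(* [q] evaluates [A] to the complex conjugate of its semisimple part. *)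
Lemma conjugate_part : exists q : {poly C},
  (forall a k v, v *m horner_mx A (('X - a%:P) ^+ k) = 0 ->
     v *m horner_mx A q = a^* *: v) /\
  (\tr (A *m horner_mx A q) = 0 -> A ^+ n.+1 = 0).
Proof.
have [s sz [s0 tr_s]] := char_poly_split.
have [q qP] := poly_interpolation n.+1 Num.conj (undup_uniq s).
have {}qP a : a \in s -> ('X - a%:P) ^+ n.+1 %| q - (a^* )%:P.
  by move=> ain; apply: qP; rewrite mem_undup.
exists q; split.
  move=> a k v vk.
  (* The gcd of [('X - a%:P) ^+ k] with the characteristic polynomial still kills [v] and is, up to
     a unit, some [('X - a%:P) ^+ j]. Either [j = 0] and [v = 0], or [a] is an eigenvalue and
     [j <= n.+1], within the precision to which [q] interpolates. *)
  have vg := horner_mx_gcdp vk (etrans (congr1 (mulmx v) s0) (mulmx0 _ _)).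
  have /dvdp_exp_XsubCP[j _ gj] := dvdp_gcdl (('X - a%:P) ^+ k)
    (\prod_(b <- s) ('X - b%:P)).
  have vj : v *m horner_mx A (('X - a%:P) ^+ j) = 0.
    by apply: horner_mx_dvdp vg; rewrite (eqp_dvdl _ gj).
  have jdvd : ('X - a%:P) ^+ j %| \prod_(b <- s) ('X - b%:P).
    by rewrite -(eqp_dvdl _ gj) dvdp_gcdr.
  case: j => [|j] in gj vj jdvd.
    by move: vj; rewrite expr0 rmorph1 mulmx1 => ->; rewrite mul0mx scaler0.
  have ain : a \in s.
    by rewrite -root_prod_XsubC -dvdp_XsubCl (dvdp_trans _ jdvd)// exprS dvdp_mulr.
  have jn : (j.+1 <= n.+1)%N.
    have := dvdp_leq (monic_neq0 (monic_prod_XsubC _ _ _)) jdvd.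
    by rewrite size_exp_XsubC size_prod_XsubC sz.
  have : v *m horner_mx A (q - (a^* )%:P) = 0.
    by apply: horner_mx_dvdp vj; apply: dvdp_trans (qP _ ain); rewrite dvdp_exp2l.
  rewrite rmorphB /= horner_mx_C mulmxBr => /eqP.
  by rewrite subr_eq0 mul_mx_scalar => /eqP.
rewrite tr_s => [|a /qP/(dvdp_trans (dvdp_exp2l _ (ltn0Sn n)))]; last first.
  by rewrite expr1 dvdp_XsubCl rootE !hornerE subr_eq0 => /eqP.
(* A vanishing sum of squared moduli makes every eigenvalue zero, so the characteristic polynomial
   is a power of ['X]. *)
move/eqP; rewrite psumr_eq0 => [/allP s_0|a _]; last by rewrite exprn_ge0.
have sE : \prod_(a <- s) ('X - a%:P) = 'X^(size s).
  elim: {sz s0 tr_s qP} s s_0 => [_|a s IH s_0]; first by rewrite big_nil.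
  rewrite big_cons IH => [|b bs]; last by rewrite s_0// inE bs orbT.
  have := s_0 a (mem_head _ _); rewrite /= expf_eq0/= normr_eq0 => /eqP ->.
  by rewrite subr0 exprS.
by move: s0; rewrite sE sz rmorphXn /= horner_mx_X.
Qed.

End OneMatrix.

Lemma iter_horner_mx n (A : 'M[C]_n.+1) a k (v : 'rV_n.+1) :
  iter k (fun w => w *m A - a *: w) v = v *m horner_mx A (('X - a%:P) ^+ k).
Proof.
elim: k => [|k IH]; first by rewrite expr0 rmorph1 mulmx1.
rewrite exprSr mul_horner_mxM iterS IH rmorphB /= horner_mx_X horner_mx_C.
by rewrite mulmxBr mul_mx_scalar.
Qed.

(** Covers size 0 as well, and expresses generalized eigenvectors by iteration, a form that
    transfers to endomorphisms. *)
Lemma conjugate_part_mx n (A : 'M[C]_n) : exists B : 'M[C]_n,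
  (forall a k (v : 'rV_n), iter k (fun w => w *m A - a *: w) v = 0 ->
     v *m B = a^* *: v) /\
  (\tr (A *m B) = 0 -> forall v : 'rV_n, iter n (mulmx^~ A) v = 0).
Proof.
case: n A => [|n] A.
  by exists 0; split=> [a k v _|_ v]; rewrite ?(thinmx0 v) ?mul0mx ?scaler0.
have [q [qgen qtr]] := conjugate_part A; exists (horner_mx A q); split.
  by move=> a k v; rewrite iter_horner_mx; apply: qgen.
move=> /qtr A0 v; have := iter_horner_mx A 0 n.+1 v.
rewrite subr0 rmorphXn /= horner_mx_X A0 mulmx0 => <-.
by elim: (X in iter X) => [|k] /=; [|move->]; rewrite ?scale0r ?subr0.
Qed.

Lemma generalized_eigen_ind_mx n (A : 'M[C]_n) (P : 'rV_n -> Prop) :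
  (forall u v, P u -> P v -> P (u + v)) ->
  (forall a k v, iter k (fun w => w *m A - a *: w) v = 0 -> P v) ->
  forall v, P v.
Proof.
case: n A P => [|n] A P PD Pgen.
  by move=> v; apply: (Pgen 0 0%N); rewrite /= thinmx0.
apply: (generalized_eigen_ind (A := A)) => // a k v; rewrite -iter_horner_mx.
exact: Pgen.
Qed.

End ConjugatePart.

(** * Lie brackets, Engel's theorem and Cartan's criterion *)

Section Trace.
Variables (K : fieldType) (V : vectType K).
Implicit Types u v : 'End(V).
Local Notation e := (vbasis (fullv : {vspace V})).

Lemma end_trace_mxof u : end_trace u = \tr (mxof e e u).
Proof.
apply: eq_bigr => i _; rewrite !mxE /=; congr (coord _ _ (u _)).
by rewrite vecof_delta.
Qed.

Lemma end_traceC u v : end_trace (u \o v)%VF = end_trace (v \o u)%VF.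
Proof.
have eb := vbasisP (fullv : {vspace V}).
by rewrite !end_trace_mxof !(mxof_comp e e eb) mxtrace_mulC.
Qed.

Lemma end_traceP a u v :
  end_trace (a *: u + v) = a * end_trace u + end_trace v.
Proof. by rewrite !end_trace_mxof linearP mxtraceD mxtraceZ. Qed.

Lemma end_traceB u v : end_trace (u - v) = end_trace u - end_trace v.
Proof. by rewrite !end_trace_mxof linearB raddfB. Qed.

End Trace.

(** * Transfer of the conjugate part to endomorphisms *)

Section ConjugateEndo.
Variables (C : numClosedFieldType) (V : vectType C) (D : 'End(V)).
Local Notation e := (vbasis (fullv : {vspace V})).
Let eb := vbasisP (fullv : {vspace V}).

Lemma rVof_iter a k v : rVof e (iter k (fun w => D w - a *: w) v) =
  iter k (fun w => w *m mxof e e D - a *: w) (rVof e v).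
Proof. by elim: k => //= k <-; rewrite linearB linearZ /= (rVof_app e eb). Qed.

Lemma generalized_eigen_lfun_ind (P : V -> Prop) :
  (forall u v, P u -> P v -> P (u + v)) ->
  (forall a k v, iter k (fun w => D w - a *: w) v = 0 -> P v) ->
  forall v, P v.
Proof.
move=> PD Pgen v; rewrite -(rVofK eb v).
apply: (generalized_eigen_ind_mx (A := mxof e e D)
  (P := fun r => P (vecof e r))) => [r s|a k r r0].
  by rewrite linearD; apply: PD.
apply: (Pgen a k); apply/eqP; rewrite -(rVof_eq0 eb) rVof_iter.
by rewrite vecofK// r0.
Qed.

Lemma conjugate_part_lfun : exists Y : 'End(V),
  (forall a k v, iter k (fun w => D w - a *: w) v = 0 -> Y v = a^* *: v) /\
  (end_trace (D \o Y)%VF = 0 -> exists k, forall v, iter k D v = 0).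
Proof.
have [B [Bgen Btr]] := conjugate_part_mx (mxof e e D).
exists (hommx e e B); split=> [a k v v0|].
  apply: (can_inj (rVofK eb)); rewrite -(rVof_mul eb eb) linearZ.
  by apply: (Bgen a k); rewrite -rVof_iter v0 linear0.
(* Matrices act on row vectors and reverse compositions, so the factors are swapped first to reach
   [\tr (A *m B)]. *)
rewrite end_traceC end_trace_mxof (mxof_comp e e eb) (hommxK eb eb) => /Btr D0.
have iterD k v : rVof e (iter k D v) = iter k (mulmx^~ (mxof e e D)) (rVof e v).
  by elim: k => //= k <-; rewrite (rVof_app e eb).
exists (\dim (fullv : {vspace V})) => v; apply/eqP.
by rewrite -(rVof_eq0 eb) iterD D0.
Qed.

End ConjugateEndo.

(** * Bilinearity, brackets of subspaces and Engel's theorem *)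

Section Bracket.
Variables (K : fieldType) (n : nat) (G : set 'M[K]_n).
Local Notation g := (lieAlg G).
Implicit Types (x y z : g) (I J M U : {vspace g}).

Fact brk_linear x : linear (brk x).
Proof.
move=> a y z; rewrite /brk -linearP /=; congr (vsproj _ _).
rewrite mulmxDr mulmxDl -scalemxAr -scalemxAl scalerBr.
by rewrite addrACA opprD.
Qed.
HB.instance Definition _ x :=
  GRing.isLinear.Build K g g *:%R (brk x) (brk_linear x).

Lemma brkC x y : brk y x = - brk x y.
Proof. by rewrite /brk -[RHS]raddfN opprB. Qed.

Lemma brk_linear_l y : linear (@brk K n G ^~ y).
Proof.
by move=> a x z; rewrite ![brk _ y]brkC linearP opprD scalerN.
Qed.

Lemma brkDl x y z : brk (x + y) z = brk x z + brk y z.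
Proof. by have := brk_linear_l z 1 x y; rewrite !scale1r. Qed.

Lemma brkZl a x z : brk (a *: x) z = a *: brk x z.
Proof. by rewrite brkC linearZ -scalerN -brkC. Qed.

Lemma adE x y : ad x y = brk x y.
Proof. by rewrite lfunE. Qed.

Lemma ad_linear : linear (@ad K n G).
Proof.
move=> a x y; apply/lfunP => z.
by rewrite add_lfunE scale_lfunE !adE brkDl brkZl.
Qed.
HB.instance Definition _ :=
  GRing.isLinear.Build K g 'End(g) *:%R (@ad K n G) ad_linear.

Lemma killingC x y : killing x y = killing y x.
Proof. exact: end_traceC. Qed.

Fact killing_linear x : linear (killing x : g -> K^o).
Proof.
move=> a y z; rewrite /killing linearP /=.
by rewrite comp_lfunDr -comp_lfunZr end_traceP.
Qed.
HB.instance Definition _ x :=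
  GRing.isLinear.Build K g K^o *:%R (killing x : g -> K^o) (killing_linear x).

Lemma killing0r x : killing x 0 = 0.
Proof. exact: (linear0 (killing x : {linear g -> K^o})). Qed.

Lemma killingDr x y z : killing x (y + z) = killing x y + killing x z.
Proof. exact: (linearD (killing x : {linear g -> K^o})). Qed.

Lemma killingNr x y : killing x (- y) = - killing x y.
Proof. exact: (linearN (killing x : {linear g -> K^o})). Qed.

Lemma killingDl x y z : killing (x + y) z = killing x z + killing y z.
Proof. by rewrite killingC killingDr ![killing z _]killingC. Qed.

Lemma killingNl x y : killing (- x) y = - killing x y.
Proof. by rewrite killingC killingNr killingC. Qed.

Lemma mem_brkv I J x y : x \in I -> y \in J -> brk x y \in brkv I J.
Proof.
move=> xI yJ; rewrite (coord_vbasis xI) (coord_vbasis yJ) linear_sum /=.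
apply: memv_suml => j _; rewrite linearZ /= memvZ// brkC linear_sum /= -sumrN.
apply: memv_suml => i _; rewrite linearZ /= -scalerN -brkC memvZ//.
by apply/memv_span/allpairsP; exists ((vbasis I)`_i, (vbasis J)`_j);
  rewrite !mem_nth ?size_tuple.
Qed.

Lemma brkv_subP I J U :
  reflect (forall x y, x \in I -> y \in J -> brk x y \in U) (brkv I J <= U)%VS.
Proof.
apply: (iffP idP) => [IJU x y xI yJ|IJU].
  exact: subvP IJU _ (mem_brkv xI yJ).
by apply/span_subvP => _ /allpairsP[[x y] /= [xI yJ ->]]; apply: IJU;
  apply: vbasis_mem.
Qed.

Lemma brkvS I I' J J' : (I <= I' -> J <= J' -> brkv I J <= brkv I' J')%VS.
Proof.
move=> /subvP sI /subvP sJ; apply/brkv_subP => x y /sI xI /sJ.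
exact: mem_brkv.
Qed.


Hypothesis jacobi :
  forall x y z, brk x (brk y z) = brk (brk x y) z + brk y (brk x z).

Definition subalgebra M := forall x y, x \in M -> y \in M -> brk x y \in M.

(** The descending sequence of iterated brackets of [M] with the whole algebra. It reaches 0 exactly
    when all sufficiently long products of operators [ad m], with [m] in [M], vanish. *)
Local Notation flag M := (fun i => iter i (brkv M) fullv).

Lemma flag_sub M i : (flag M i.+1 <= flag M i)%VS.
Proof. by elim: i => [|i IH]; rewrite ?subvf //= brkvS. Qed.

(** By the Jacobi identity [ad x] is a derivation; since it normalizes [M], it preserves every layer
    built from [M]. *)
Lemma flag_stable M x i : (forall m, m \in M -> brk m x \in M) ->
  forall v, v \in flag M i -> brk x v \in flag M i.
Proof.
move=> xM; elim: i => [v _|i IH] /=; first exact: memvf.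
suff /subvP sub : (brkv M (flag M i) <= ad x @^-1: brkv M (flag M i))%VS.
  by move=> v /sub; rewrite -memv_preim adE.
apply/brkv_subP => m v mM vi; rewrite -memv_preim adE jacobi memvD//.
  by rewrite mem_brkv// brkC memvN xM.
by rewrite mem_brkv// IH.
Qed.

(* On each layer of the flag of [M], the enlarged algebra [M + <[x]>] acts
   through the nilpotent [ad x]. *)
Lemma flag_extension M x k r : (forall m, m \in M -> brk m x \in M) ->
  flag M k = 0%VS -> (forall v, iter r (ad x) v = 0) ->
  flag (M + <[x]>)%VS (k * r)%N = 0%VS.
Proof.
(* Replacing 0 by [flag M k] turns the goal into an inclusion that can be proved by induction on
   [k]. *)
move=> xM Mk xr; apply/eqP; rewrite -subv0 -Mk {Mk}.
elim: k => [|k IH]; first by rewrite subvf.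
pose W j := iter j (fun U => ad x @: U)%VS (flag M k).
have W_sub j : (W j <= flag M k)%VS.
  elim: j => //= j /subvP IHj; apply/subvP => _ /memv_imgP[v /IHj vk ->].
  by rewrite adE flag_stable.
have Wr : W r = 0%VS.
  have memW j v : v \in W j -> exists2 w, w \in flag M k & v = iter j (ad x) w.
    elim: j v => [|j IHj] v /=; first by exists v.
    by case/memv_imgP => w /IHj[u uk ->] ->; exists u.
  apply/eqP; rewrite -subv0; apply/subvP => v /memW[w _ ->].
  by rewrite xr mem0v.
(* A bracket with an element of [M + <[x]>] has two effects: its [x] part moves [W j] to [W j.+1],
   and its [M] part lands in the next layer. After [r] brackets only the next layer remains. *)
have step j : (iter j (brkv (M + <[x]>)) (flag (M + <[x]>)%VS (k * r)%N) <=
               W j + flag M k.+1)%VS.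
  elim: j => [|j /subvP IHj] /=; first by apply: subv_trans (addvSl _ _).
  apply/brkv_subP => _ v /memv_addP[m mM [_ /vlineP[c ->] ->]].
  case/IHj/memv_addP => w wj [u uk ->].
  have -> : brk (m + c *: x) (w + u) =
      c *: brk x w + (brk m (w + u) + c *: brk x u).
    by rewrite brkDl brkZl [brk x _]linearD scalerDr addrCA.
  rewrite memv_add//; first by rewrite memvZ// -adE memv_img.
  rewrite memvD//; last by rewrite memvZ// (flag_stable (i := k.+1)).
  rewrite mem_brkv// memvD//; first exact: subvP (W_sub j) _ wj.
  exact: subvP (flag_sub M k) _ uk.
by have := step r; rewrite Wr add0v -iterD -mulSn.
Qed.

(** A subalgebra [M] of [N] of maximal dimension among those whose flag reaches 0 must be [N]:
    otherwise some [x] in [N] outside [M] normalizes [M], and [flag_extension] enlarges it. *)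
Theorem engel N : subalgebra N ->
  (forall x, x \in N -> exists r, forall v, iter r (ad x) v = 0) ->
  exists k, flag N k = 0%VS.
Proof.
move=> subN nilN.
pose P d := `[< exists M, [/\ \dim M = d, (M <= N)%VS, subalgebra M &
  exists k, flag M k = 0%VS] >].
have exP : exists d, P d.
  exists 0%N; apply/asboolP; exists 0%VS; split; rewrite ?dimv0 ?sub0v//.
    by move=> x y; rewrite !memv0 => /eqP -> _; rewrite brkC linear0 oppr0.
  exists 1%N; apply/eqP; rewrite -subv0; apply/brkv_subP => x y.
  by rewrite !memv0 => /eqP -> _; rewrite brkC linear0 oppr0.
have ubP d : P d -> (d <= \dim N)%N.
  by case/asboolP => M [<- MN _ _]; apply: dimvS.
case: (ex_maxnP exP ubP) => _ /asboolP[M [<- MN subM [k Mk]]] maxM.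
case: (boolP (N <= M)%VS) => [NM|NM].
  by exists k; have /eqP <- : M == N by rewrite eqEsubv MN.
have exj : exists j, (iter j (brkv M) N <= M)%VS.
  exists k; apply: subv_trans (sub0v M); rewrite -Mk.
  by elim: (k) => [|j IH]; rewrite ?subvf //= brkvS.
(* Index 0 would give [N <= M]. At the minimal index [j.+1], the term before it is not inside [M]
   but its bracket with [M] is, which yields a normalizing [x]. *)
case: (ex_minnP exj) => -[|j] jM minj; first by rewrite jM in NM.
have [x xj xM] : exists2 x, x \in iter j (brkv M) N & x \notin M.
  apply/subvPn; apply/negP => /minj; by rewrite ltnn.
have xN : x \in N.
  suff /subvP : (iter j (brkv M) N <= N)%VS by apply.
  elim: (j) => //= i IH; apply/brkv_subP => y z yM zi.
  by apply: subN; [apply: subvP MN _ yM | apply: subvP IH _ zi].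
have Mx m : m \in M -> brk m x \in M.
  by move=> mM; apply: subvP jM _ _; rewrite mem_brkv.
have [r xr] := nilN x xN.
have subMx : subalgebra (M + <[x]>)%VS.
  move=> u w /memv_addP[m mM [_ /vlineP[c ->] ->]].
  case/memv_addP => m' m'M  [_ /vlineP[c' ->] ->].
  apply: (subvP (addvSl _ _)); rewrite brkDl !linearD !linearZ /= !brkZl.
  have xx : brk x x = 0 by rewrite /brk subrr linear0.
  rewrite xx !scaler0 addr0 [brk x m']brkC scalerN.
  by rewrite !(memvD, memvN, memvZ, Mx, subM).
have : P (\dim (M + <[x]>)%VS).
  apply/asboolP; exists (M + <[x]>)%VS; split=> //.
    by rewrite subv_add MN -memvE.
  by exists (k * r)%N; apply: flag_extension.
move/maxM => le; case/negP: xM.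
have /eqP -> : M == (M + <[x]>)%VS by rewrite eqEdim addvSl.
by rewrite (subvP (addvSr _ _)) // memv_line.
Qed.

(** The derived series of [N] stays inside [N], so each of its terms lies in the corresponding layer
    of [flag N]. *)
Lemma engel_solvable N : subalgebra N ->
  (forall x, x \in N -> exists r, forall v, iter r (ad x) v = 0) ->
  lie_solvable N.
Proof.
move=> subN /(engel subN)[k Nk]; exists k; apply/eqP; rewrite -subv0 -Nk.
suff /andP[] : (iter k (fun J => brkv J J) N <= N)%VS &&
  (iter k (fun J => brkv J J) N <= flag N k)%VS by [].
elim: {Nk} k => [|k /andP[kN kk]]; rewrite ?subvv ?subvf //=.
rewrite brkvS// andbT; apply/brkv_subP => x y xk yk.
by apply: subN; apply: subvP kN _ _.
Qed.

End Bracket.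

Lemma lfun_linearE (K : fieldType) (V W : vectType K) (f : V -> W) :
  linear f -> linfun f =1 f.
Proof.
move=> lf v; pose mixin := GRing.isLinear.Build K V W *:%R f lf.
pose F : {linear V -> W} := HB.pack f mixin.
exact: (lfunE F).
Qed.

(** * Invariance of the Killing form and traces against derivations *)

Section Killing.
Variables (K : fieldType) (n : nat) (G : set 'M[K]_n).
Local Notation g := (lieAlg G).
Implicit Types (x y z : g) (I : {vspace g}).
Hypothesis jacobi :
  forall x y z, brk x (brk y z) = brk (brk x y) z + brk y (brk x z).

Lemma brkBl x y z : brk (x - y) z = brk x z - brk y z.
Proof. by rewrite brkDl -scaleN1r brkZl scaleN1r. Qed.

Lemma ad_brk x y : ad (brk x y) = (ad x \o ad y)%VF - (ad y \o ad x)%VF.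
Proof.
apply/lfunP => z; rewrite add_lfunE opp_lfunE !comp_lfunE !adE.
by rewrite (jacobi x y z) addrK.
Qed.

(** Cyclicity of the trace. *)
Lemma killing_brk x y z : killing (brk x y) z = killing x (brk y z).
Proof.
rewrite /killing !ad_brk comp_lfunDl comp_lfunNl comp_lfunDr comp_lfunNr.
rewrite !end_traceB -!comp_lfunA; congr (_ - _).
by rewrite end_traceC comp_lfunA.
Qed.

(** For a derivation, [ad y] composed with [Y] differs from [Y] composed with [ad y] by
    [- ad (Y y)]. Hence the trace for [brk x y] equals [- killing x (Y y)], which is 0 for [x] in
    [I]. *)
Lemma trace_derivation (Y : 'End(g)) I :
  (forall u v, Y (brk u v) = brk (Y u) v + brk u (Y v)) ->
  (forall x y, x \in I -> killing x y = 0) ->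
  forall z, z \in brkv I I -> end_trace (ad z \o Y)%VF = 0.
Proof.
move=> Yder I0 z zI.
pose t x : K^o := end_trace (ad x \o Y)%VF.
have tE x : linfun t x = t x.
  apply: lfun_linearE => a u v; rewrite /t linearP comp_lfunDl -comp_lfunZl.
  by rewrite end_traceP.
suff /subvP/(_ z zI) : (brkv I I <= lker (linfun t))%VS.
  by rewrite memv_ker tE => /eqP.
apply/brkv_subP => x y xI _; rewrite memv_ker tE /t ad_brk; apply/eqP.
have YadyE : (ad y \o Y)%VF = (Y \o ad y)%VF - ad (Y y).
  apply/lfunP => w; rewrite add_lfunE opp_lfunE !comp_lfunE !adE Yder.
  by rewrite addrAC subrr add0r.
rewrite comp_lfunDl comp_lfunNl end_traceB -!comp_lfunA YadyE.
rewrite comp_lfunDr comp_lfunNr end_traceB [end_trace (ad x \o ad _)%VF]I0//.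
by rewrite subr0 comp_lfunA end_traceC subrr.
Qed.

Lemma kappaE x y : kappa G x y = killing x y.
Proof.
rewrite /kappa lfun_linearE ?lfunE// => a u v; apply/lfunP => w.
rewrite add_lfunE scale_lfunE !lfunE /= ![killing _ w]killingC.
exact: (linearP (killing w)).
Qed.

End Killing.

(** * Cartan's criterion *)

Section CartanCriterion.
Variables (C : numClosedFieldType) (n : nat) (G : set 'M[C]_n).
Local Notation g := (lieAlg G).
Implicit Types (x y z u v : g) (I : {vspace g}).
Hypothesis jacobi :
  forall x y z, brk x (brk y z) = brk (brk x y) z + brk y (brk x z).

(** Leibniz rule for the shifted operators [D a], [D b] and [D (a + b)], followed by a double
    induction on the exponents. *)
Lemma brk_generalized_eigen x a b k l u v :
  iter k (fun w => ad x w - a *: w) u = 0 ->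
  iter l (fun w => ad x w - b *: w) v = 0 ->
  iter (k + l) (fun w => ad x w - (a + b) *: w) (brk u v) = 0.
Proof.
set D := fun c w => ad x w - c *: w; rewrite -!/(D _).
have Dbrk s t : D (a + b) (brk s t) = brk (D a s) t + brk s (D b t).
  rewrite /D !adE jacobi [brk s (_ - _)]linearB /= [brk s (b *: _)]linearZ /=.
  by rewrite brkBl brkZl scalerDl opprD addrACA.
have iterD m s t : iter m (D (a + b)) (s + t) =
    iter m (D (a + b)) s + iter m (D (a + b)) t.
  by elim: m => //= m ->; rewrite /D linearD scalerDr opprD addrACA.
have iter0 m : iter m (D (a + b)) 0 = 0.
  by elim: m => //= m ->; rewrite /D linear0 scaler0 subr0.
elim: k l u v => [|k IHk] l u v.
  by move=> /= -> _; rewrite brkC linear0 oppr0 iter0.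
elim: l v => [|l IHl] v Du Dv; first by rewrite (Dv : v = 0) linear0 iter0.
rewrite addSn iterSr Dbrk iterD (IHk l.+1) -?iterSr// add0r addnS -addSn.
by apply: IHl; rewrite -?iterSr.
Qed.

(** Bilinearity reduces to generalized eigenvectors for [a] and [b]. Their bracket belongs to
    [a + b], and conjugation is additive. *)
Lemma conjugate_part_derivation x (Y : 'End(g)) :
  (forall a k v, iter k (fun w => ad x w - a *: w) v = 0 -> Y v = a^* *: v) ->
  forall u v, Y (brk u v) = brk (Y u) v + brk u (Y v).
Proof.
move=> Ygen u v.
elim/(generalized_eigen_lfun_ind (D := ad x)): u => [u u' Hu Hu'|a k u u0].
  by rewrite !(brkDl, linearD) /= Hu Hu' addrACA.
elim/(generalized_eigen_lfun_ind (D := ad x)): v => [v v' Hv Hv'|b l v v0].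
  by rewrite !linearD /= Hv Hv' addrACA.
rewrite (Ygen _ _ _ (brk_generalized_eigen u0 v0)).
rewrite (Ygen _ _ _ u0) (Ygen _ _ _ v0).
by rewrite brkZl linearZ /= -scalerDl rmorphD.
Qed.

Lemma killing_radical_solvable I :
  (forall x y, x \in I -> brk x y \in I) ->
  (forall x y, x \in I -> killing x y = 0) -> lie_solvable I.
Proof.
move=> idealI I0.
have subI : subalgebra (brkv I I).
  have /subvP sI : (brkv I I <= I)%VS.
    by apply/brkv_subP => x y xI _; apply: idealI.
  by move=> x y /sI xI /sI yI; apply: mem_brkv.
(* The derived series of [I] is that of [brkv I I] delayed by one step; the trace argument gives
   nilpotency only on [brkv I I]. *)
suff [k Ik] : lie_solvable (brkv I I) by exists k.+1; rewrite iterSr.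
apply: engel_solvable => // x xI.
have [Y [Ygen]] := conjugate_part_lfun (ad x); apply.
exact: trace_derivation (conjugate_part_derivation Ygen) I0 _ xI.
Qed.

(** Invariance makes the radical of the Killing form an ideal; it is solvable, so semisimplicity
    makes it 0. *)
Theorem cartan_criterion : lie_semisimple G ->
  forall x, (forall y, killing x y = 0) -> x = 0.
Proof.
move=> ssG.
pose kerK := lker (kappa G).
have memK x : x \in kerK <-> forall y, killing x y = 0.
  rewrite memv_ker; split=> [/eqP x0 y|x0]; first by rewrite -kappaE x0 lfunE.
  by apply/eqP/lfunP => y; rewrite kappaE x0 lfunE.
suff K0 : kerK = 0%VS by move=> x /memK; rewrite K0 memv0 => /eqP.
have idealK x y : x \in kerK -> brk x y \in kerK.
  by move=> /memK x0; apply/memK => z; rewrite (killing_brk jacobi) x0.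
apply: ssG.
  by move=> x y yI; rewrite brkC memvN idealK.
apply: killing_radical_solvable => // x y /memK; exact.
Qed.

End CartanCriterion.

(** * Germs of regular functions and their differentials *)

Section PolynomialFunctions.
Variables (K : fieldType) (V : vectType K).
Implicit Types (p q : polyOn V) (x v : V).
Local Notation crd := (coord (vbasis (fullv : {vspace V}))).

Lemma pevalD p q x : peval (p + q) x = peval p x + peval q x.
Proof. exact: mevalD. Qed.

Lemma pevalB p q x : peval (p - q) x = peval p x - peval q x.
Proof. exact: mevalB. Qed.

Lemma pevalM p q x : peval (p * q) x = peval p x * peval q x.
Proof. exact: mevalM. Qed.

Lemma pevalC c x : peval (mpolyC _ c : polyOn V) x = c.
Proof. exact: mevalC. Qed.

Lemma peval1 x : peval (1 : polyOn V) x = 1.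
Proof. exact: meval1. Qed.

Lemma peval0 x : peval (0 : polyOn V) x = 0.
Proof. exact: meval0. Qed.

Lemma pevalX i x : peval (mpolyX _ (mnm1 i) : polyOn V) x = crd i x.
Proof. exact: mevalXU. Qed.

Lemma pdiffD p q x v : pdiff (p + q) x v = pdiff p x v + pdiff q x v.
Proof.
rewrite /pdiff -big_split /=; apply: eq_bigr => i _.
by rewrite mderivD pevalD mulrDl.
Qed.

Lemma pdiffM p q x v :
  pdiff (p * q) x v = pdiff p x v * peval q x + peval p x * pdiff q x v.
Proof.
rewrite /pdiff mulr_suml mulr_sumr -big_split /=; apply: eq_bigr => i _.
by rewrite mderivM pevalD !pevalM mulrDl mulrAC mulrA.
Qed.

Lemma pdiffC c x v : pdiff (mpolyC _ c : polyOn V) x v = 0.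
Proof. by apply: big1 => i _; rewrite mderivC peval0 mul0r. Qed.

Lemma pdiff1 x v : pdiff (1 : polyOn V) x v = 0.
Proof. exact: pdiffC. Qed.

Lemma pdiffX i x v : pdiff (mpolyX _ (mnm1 i) : polyOn V) x v = crd i v.
Proof.
rewrite /pdiff (bigD1 i) //= big1 => [|j ji].
  have UU0 : mnm_sub (mnm1 i) (mnm1 i) = mnm0.
    by rewrite -[X in mnm_sub X _]add0m addmK.
  by rewrite addr0 mderivX mnm1E eqxx scale1r UU0 mpolyX0 peval1 mul1r.
by rewrite mderivX mnm1E eq_sym (negPf ji) scale0r peval0 mul0r.
Qed.

Lemma pdiffP p x a u v : pdiff p x (a *: u + v) = a * pdiff p x u + pdiff p x v.
Proof.
rewrite /pdiff mulr_sumr -big_split /=; apply: eq_bigr => i _.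
by rewrite linearP mulrDr mulrCA.
Qed.

(** Induction along the ring operations, so that differentiation rules need checking only on
    constants, coordinates, sums and products. *)
Lemma polyOn_ind (P : polyOn V -> Prop) :
  (forall c, P (mpolyC _ c)) -> (forall i, P (mpolyX _ (mnm1 i))) ->
  (forall p q, P p -> P q -> P (p + q)) ->
  (forall p q, P p -> P q -> P (p * q)) -> forall p, P p.
Proof.
move=> PC PX PD PM; elim/mpolyind => [|c m p _ _ Pp]; first exact: PC.
apply: PD => //; rewrite -mul_mpolyC; apply: (PM) => //.
rewrite mpolyXE_id; elim/big_rec: _ => [|i q _ Pq]; first exact: PC.
apply: (PM) => //; elim: (m i) => [|k IH]; first exact: PC.
by rewrite exprS; apply: (PM).
Qed.

End PolynomialFunctions.

Section Zariski.
Variables (K : fieldType) (V : vectType K).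
Implicit Types (p q : polyOn V) (x v : V) (U : set V).

Lemma zopen_basis U x : zopen U -> U x ->
  exists p, peval p x != 0 /\ forall y, peval p y != 0 -> U y.
Proof.
move=> [P UP] Ux.
have : ~ (~` U)%classic x by move=> /(_ Ux).
rewrite UP => /existsNP[p /not_implyP[Pp px]]; exists p.
split=> [|y py]; first exact/eqP.
apply: contrapT => nUy.
have : (~` U)%classic y by [].
by rewrite UP => /(_ _ Pp) /eqP; rewrite (negPf py).
Qed.

(** The complement is cut out by all polynomials whose nonvanishing locus lies in [U]. *)
Lemma zopen_locally U :
  (forall x, U x -> exists p, peval p x != 0 /\ forall y, peval p y != 0 -> U y) ->
  zopen U.
Proof.
move=> loc; exists [set p | forall y, peval p y != 0 -> U y]%classic.
apply/seteqP; split=> [x nUx p pU|x px Ux].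
  by apply/eqP/contraT => /pU.
by have [p [/eqP pn /px]] := loc x Ux.
Qed.

Lemma zopen_neq0 p : zopen [set x | peval p x != 0]%classic.
Proof. by apply: zopen_locally => x px; exists p. Qed.

Lemma zopenT : zopen (setT : set V).
Proof. by apply: zopen_locally => x _; exists 1; rewrite peval1 oner_neq0. Qed.

Lemma zopenI U U' : zopen U -> zopen U' -> zopen (U `&` U')%classic.
Proof.
move=> oU oU'; apply: zopen_locally => x [Ux U'x].
have [p [px pU]] := zopen_basis oU Ux; have [q [qx qU]] := zopen_basis oU' U'x.
exists (p * q); split=> [|y]; rewrite pevalM mulf_eq0 negb_or; first by rewrite px.
by case/andP => /pU ? /qU ?.
Qed.

End Zariski.

Section Germs.
Variables (K : fieldType) (V : vectType K).
Implicit Types (p q : polyOn V) (X U : set V) (f h : V -> K) (x v : V).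

Definition frac_diff (pq : polyOn V * polyOn V) x v :=
  (peval pq.2 x * pdiff pq.1 x v - peval pq.1 x * pdiff pq.2 x v)
    / peval pq.2 x ^+ 2.

(** A relational counterpart of [rdiff]: some fraction represents the germ and has differential
    [df]. The rules of calculus then hold on all vectors, while [rdiff], with its chosen fraction,
    is recovered on tangent vectors by [rdiff_eq]. *)
Definition has_rdiff X f x (df : V -> K) :=
  exists2 pq, regular_germ X f x pq & forall v, frac_diff pq x v = df v.

Lemma has_rdiff_eq X f h x df dh : has_rdiff X f x df -> f =1 h -> df =1 dh ->
  has_rdiff X h x dh.
Proof. by move=> Hf /funext <- /funext <-. Qed.

Lemma has_rdiff_local X U f h x df : zopen U -> U x ->
  (forall y, X y -> U y -> f y = h y) ->
  has_rdiff X f x df -> has_rdiff X h x df.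
Proof.
move=> oU Ux fh [pq [W [oW Wx Wpq]] dpq]; exists pq => //.
exists (U `&` W)%classic; split; [exact: zopenI|by []|].
by move=> y Xy [Uy Wy]; rewrite -fh//; apply: Wpq.
Qed.

Lemma has_rdiff_poly X p x : has_rdiff X (peval p) x (pdiff p x).
Proof.
exists (p, 1) => [|v].
  exists setT; split=> [|//|y _ _]; first exact: zopenT.
    by rewrite /= peval1 divr1 oner_neq0.
by rewrite /frac_diff /= peval1 pdiff1 mulr0 subr0 mul1r expr1n divr1.
Qed.

Lemma has_rdiff_cst X c x : has_rdiff X (fun=> c) x (fun=> 0).
Proof.
apply: has_rdiff_eq (has_rdiff_poly X (mpolyC _ c) x) (fun y => pevalC c y) _ => v.
exact: pdiffC.
Qed.

Lemma has_rdiffD X f h x df dh : X x -> has_rdiff X f x df ->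
  has_rdiff X h x dh -> has_rdiff X (fun y => f y + h y) x (fun v => df v + dh v).
Proof.
move=> Xx [[p q] [U [oU Ux Upq]] /= dpq] [[p' q'] [U' [oU' Ux' Upq']] /= dpq'].
have [/= q0 _] := Upq x Xx Ux; have [/= q'0 _] := Upq' x Xx Ux'.
exists (p * q' + p' * q, q * q') => [|v] /=.
  exists (U `&` U')%classic; split; [exact: zopenI|by []|move=> y Xy [Uy U'y]].
  have [/= qy ->] := Upq y Xy Uy; have [/= q'y ->] := Upq' y Xy U'y.
  by rewrite pevalD !pevalM mulf_neq0// addf_div.
rewrite -dpq -dpq' /frac_diff /= pdiffD !pdiffM pevalD !pevalM.
by field; rewrite q0 q'0.
Qed.

Lemma has_rdiffM X f h x df dh : X x -> has_rdiff X f x df ->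
  has_rdiff X h x dh ->
  has_rdiff X (fun y => f y * h y) x (fun v => df v * h x + f x * dh v).
Proof.
move=> Xx [[p q] [U [oU Ux Upq]] /= dpq] [[p' q'] [U' [oU' Ux' Upq']] /= dpq'].
have [/= q0 fx] := Upq x Xx Ux; have [/= q'0 hx] := Upq' x Xx Ux'.
exists (p * p', q * q') => [|v] /=.
  exists (U `&` U')%classic; split; [exact: zopenI|by []|move=> y Xy [Uy U'y]].
  have [/= qy ->] := Upq y Xy Uy; have [/= q'y ->] := Upq' y Xy U'y.
  by rewrite !pevalM mulf_neq0// mulf_div.
rewrite -dpq -dpq' fx hx /frac_diff /= !pdiffM !pevalM.
by field; rewrite q0 q'0.
Qed.

Lemma has_rdiffV X f x df : X x -> f x != 0 -> has_rdiff X f x df ->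
  has_rdiff X (fun y => (f y)^-1) x (fun v => - df v / f x ^+ 2).
Proof.
move=> Xx fx0 [[p q] [U [oU Ux Upq]] /= dpq].
have [/= q0 fx] := Upq x Xx Ux.
have p0 : peval p x != 0.
  by apply: contra_neq fx0 => p0; rewrite fx p0 mul0r.
exists (q, p) => [|v] /=.
  exists (U `&` [set y | peval p y != 0])%classic; split=> //.
    exact/zopenI/zopen_neq0.
  by move=> y Xy [Uy /= py]; have [/= qy ->] := Upq y Xy Uy; rewrite py invf_div.
rewrite -dpq fx /frac_diff /=.
by field; rewrite q0 p0.
Qed.

Lemma has_rdiff_sum X x (I : Type) (r : seq I) (P : pred I) (F : I -> V -> K) dF :
  X x -> (forall i, P i -> has_rdiff X (F i) x (dF i)) ->
  has_rdiff X (fun y => \sum_(i <- r | P i) F i y) x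
    (fun v => \sum_(i <- r | P i) dF i v).
Proof.
move=> Xx HF; elim: r => [|i r IH].
  by apply: has_rdiff_eq (has_rdiff_cst X 0 x) _ _ => y; rewrite big_nil.
case: (boolP (P i)) => [Pi|/negPf Pi]; last first.
  by apply: has_rdiff_eq IH _ _ => y; rewrite big_cons Pi.
apply: has_rdiff_eq (has_rdiffD Xx (HF i Pi) IH) _ _ => y;
by rewrite big_cons Pi.
Qed.

End Germs.

(** * Tangent vectors, and independence of the differential from the fraction *)

Section Tangents.
Variables (K : fieldType) (V : vectType K).
Implicit Types (p q : polyOn V) (X : set V) (f : V -> K) (x v : V).

Lemma pdiffB p q x v : pdiff (p - q) x v = pdiff p x v - pdiff q x v.
Proof.
rewrite /pdiff -sumrB; apply: eq_bigr => i _.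
by rewrite mderivB pevalB mulrBl.
Qed.

Definition tangent X x v :=
  forall p, (forall y, X y -> peval p y = 0) -> pdiff p x v = 0.

(** Let [u] be nonzero at [x] and vanish outside a common neighbourhood. Then
    [u * (p * q' - p' * q)] vanishes on all of [X], so its differential kills [v]; dividing by [u]
    at [x] compares the two quotient rules. *)
Lemma frac_diff_unique X f x v pq pq' : X x -> tangent X x v ->
  regular_germ X f x pq -> regular_germ X f x pq' ->
  frac_diff pq x v = frac_diff pq' x v.
Proof.
case: pq pq' => [p q] [p' q'] Xx Tv [U [oU Ux Upq]] [U' [oU' U'x U'pq]].
have [u [ux uU]] := zopen_basis (zopenI oU oU') (conj Ux U'x).
have := Tv (u * (p * q' - p' * q)).
have [/= q0 fx] := Upq x Xx Ux; have [/= q'0 fx'] := U'pq x Xx U'x.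
rewrite /frac_diff /=.
move: fx fx' => /esym/(canRL (mulfVK q0)) ep /esym/(canRL (mulfVK q'0)) ep'.
rewrite pdiffM pdiffB !pdiffM pevalB !pevalM => H.
have {}H : pdiff p x v * peval q' x + peval p x * pdiff q' x v -
    (pdiff p' x v * peval q x + peval p' x * pdiff q x v) = 0.
  apply: (mulfI ux); rewrite mulr0 -[RHS]H => [|y Xy].
    by rewrite ep ep'; ring.
  rewrite pevalM pevalB !pevalM; have [->|uy] := eqVneq (peval u y) 0.
    by rewrite mul0r.
  have [Uy U'y] := uU _ uy.
  have [/= qy fy] := Upq y Xy Uy; have [/= q'y] := U'pq y Xy U'y.
  by rewrite fy => /eqP; rewrite eqr_div// => /eqP ->; rewrite subrr mulr0.
move: H; rewrite ep ep' => H.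
suff : (pdiff p x v - f x * pdiff q x v) / peval q x =
   (pdiff p' x v - f x * pdiff q' x v) / peval q' x.
  have e a b c : b != 0 -> (a - f x * c) / b = (b * a - f x * b * c) / b ^+ 2.
    by move=> b0; field.
  by rewrite (e _ _ _ q0) (e _ _ _ q'0).
apply/eqP; rewrite eqr_div// -subr_eq0; apply/eqP; rewrite -[RHS]H; ring.
Qed.

Lemma rdiff_eq X f x df v : X x -> has_rdiff X f x df -> tangent X x v ->
  rdiff X f x v = df v.
Proof.
move=> Xx [pq rpq <-] Tv; rewrite /rdiff.
apply: (frac_diff_unique Xx Tv) _ (rpq).
exact: (xgetPex (0, 0) (ex_intro (regular_germ X f x) pq rpq)).
Qed.

Lemma regular_rdiff X f x pq : regular_germ X f x pq ->
  exists2 df, has_rdiff X f x df & scalar df.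
Proof.
move=> rpq; exists (frac_diff pq x) => [|a u v]; first by exists pq.
by rewrite /frac_diff !pdiffP mulrA -mulrDl; congr (_ / _); ring.
Qed.

Lemma tangentP X x a u v : tangent X x u -> tangent X x v ->
  tangent X x (a *: u + v).
Proof. by move=> Tu Tv p p0; rewrite pdiffP Tu// Tv// mulr0 addr0. Qed.

End Tangents.

(** * Differentials of maps, the chain rule and morphisms of varieties *)

Section Maps.
Variables (K : fieldType) (V W : vectType K).
Implicit Types (X : set V) (Y : set W) (phi dphi : V -> W) (x v : V).
Local Notation crd := (coord (vbasis (fullv : {vspace W}))).

Definition has_vdiff X phi x dphi :=
  forall i, has_rdiff X (fun y => crd i (phi y)) x (fun v => crd i (dphi v)).

Lemma has_vdiff_eq X phi psi x dphi dpsi : has_vdiff X phi x dphi ->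
  phi =1 psi -> dphi =1 dpsi -> has_vdiff X psi x dpsi.
Proof. by move=> H /funext <- /funext <-. Qed.

Lemma has_rdiff_peval X phi x dphi : X x -> has_vdiff X phi x dphi ->
  forall p : polyOn W, has_rdiff X (fun y => peval p (phi y)) x
    (fun v => pdiff p (phi x) (dphi v)).
Proof.
move=> Xx Hphi; elim/polyOn_ind => [c|i|p q Hp Hq|p q Hp Hq].
- by apply: has_rdiff_eq (has_rdiff_cst X c x) _ _ => y; rewrite ?pevalC ?pdiffC.
- by apply: has_rdiff_eq (Hphi i) _ _ => y; rewrite ?pevalX ?pdiffX.
- by apply: has_rdiff_eq (has_rdiffD Xx Hp Hq) _ _ => y; rewrite ?pevalD ?pdiffD.
- by apply: has_rdiff_eq (has_rdiffM Xx Hp Hq) _ _ => y; rewrite ?pevalM ?pdiffM.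
Qed.

(** Zariski continuity at [x]: a polynomial [u] defining a basic neighbourhood pulls back to a
    fraction [a / b], and [phi] stays in [U] where [a] is nonzero. *)
Lemma preimage_locally X phi x dphi (U : set W) : X x ->
  has_vdiff X phi x dphi -> zopen U -> U (phi x) ->
  exists O : set V, [/\ zopen O, O x & forall y, X y -> O y -> U (phi y)].
Proof.
move=> Xx Hphi oU Ux; have [u [ux uU]] := zopen_basis oU Ux.
have [[a b] [O [oO Ox Oab]] _] := has_rdiff_peval Xx Hphi u.
exists (O `&` [set y | peval a y != 0])%classic; split.
- exact/zopenI/zopen_neq0.
- split=> //=; have [/= _ ex] := Oab x Xx Ox.
  by apply: contra_neq ux => a0; rewrite ex a0 mul0r.
- move=> y Xy [Oy /= ay]; have [/= b0 ey] := Oab y Xy Oy; apply: uU.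
  by rewrite ey mulf_neq0// invr_eq0.
Qed.

Lemma has_rdiff_comp X Y phi x dphi (f : W -> K) df : X x ->
  (forall y, X y -> Y (phi y)) -> has_vdiff X phi x dphi ->
  has_rdiff Y f (phi x) df ->
  has_rdiff X (fun y => f (phi y)) x (fun v => df (dphi v)).
Proof.
move=> Xx XY Hphi [[p q] [U [oU Ux Upq]] /= dpq].
have [O [oO Ox OU]] := preimage_locally Xx Hphi oU Ux.
have [/= q0 fx] := Upq _ (XY _ Xx) Ux.
have Hp := has_rdiff_peval Xx Hphi p; have Hq := has_rdiff_peval Xx Hphi q.
apply: (has_rdiff_local (f := fun y => peval p (phi y) / peval q (phi y)) oO Ox).
  by move=> y Xy Oy; have [] := Upq _ (XY _ Xy) (OU _ Xy Oy).
have Hqi := has_rdiffV (f := fun y => peval q (phi y)) Xx q0 Hq.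
apply: has_rdiff_eq (has_rdiffM Xx Hp Hqi) _ _ => // v.
by rewrite -dpq /frac_diff /=; field.
Qed.

Lemma has_vdiff_unique X phi x dphi dpsi v : X x -> tangent X x v ->
  has_vdiff X phi x dphi -> has_vdiff X phi x dpsi -> dphi v = dpsi v.
Proof.
move=> Xx Tv H1 H2; rewrite (coord_vbasis (memvf (dphi v))).
rewrite [RHS](coord_vbasis (memvf _)); apply: eq_bigr => i _; congr (_ *: _).
by rewrite -(rdiff_eq Xx (H1 i) Tv) (rdiff_eq Xx (H2 i) Tv).
Qed.

(** The pull-back of a polynomial vanishing on [Y] vanishes on [X]; the chain rule computes its
    differential, which is 0 on [v]. *)
Lemma tangent_image X Y phi x dphi v : X x -> (forall y, X y -> Y (phi y)) ->
  has_vdiff X phi x dphi -> tangent X x v -> tangent Y (phi x) (dphi v).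
Proof.
move=> Xx XY Hphi Tv p p0.
rewrite -(rdiff_eq Xx (has_rdiff_peval Xx Hphi p) Tv).
rewrite (rdiff_eq (df := fun=> 0) Xx _ Tv)//.
apply: (has_rdiff_local (f := fun=> 0) (zopenT V) I) (has_rdiff_cst X 0 x).
by move=> y Xy _; rewrite p0//; apply: XY.
Qed.

Lemma has_rdiff_scalar X phi x dphi (l : W -> K) : X x -> scalar l ->
  has_vdiff X phi x dphi ->
  has_rdiff X (fun y => l (phi y)) x (fun v => l (dphi v)).
Proof.
move=> Xx sl Hphi; pose mixin := GRing.isLinear.Build K W K^o *:%R l sl.
pose L : {linear W -> K^o} := HB.pack l mixin.
have lE w : \sum_i crd i w * l (vbasis fullv)`_i = l w.
  rewrite -[RHS]/(L w) [in RHS](coord_vbasis (memvf w)) (linear_sum L).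
  by apply: eq_bigr => i _; rewrite linearZ.
have H i (_ : true) :=
  has_rdiffM Xx (Hphi i) (has_rdiff_cst X (l (vbasis fullv)`_i) x).
have Hs := has_rdiff_sum (index_enum _) (P := xpredT) Xx H.
apply: has_rdiff_eq Hs (fun y => lE (phi y)) _ => v.
by rewrite -lE; apply: eq_bigr => i _; rewrite mulr0 addr0.
Qed.

Lemma has_vdiff_cst X c x : has_vdiff X (fun=> c) x (fun=> 0).
Proof.
move=> i; apply: has_rdiff_eq (has_rdiff_cst X (crd i c) x) _ _ => // v.
by rewrite linear0.
Qed.

Lemma has_vdiffD X phi psi x dphi dpsi : X x -> has_vdiff X phi x dphi ->
  has_vdiff X psi x dpsi ->
  has_vdiff X (fun y => phi y + psi y) x (fun v => dphi v + dpsi v).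
Proof.
move=> Xx Hphi Hpsi i; apply: has_rdiff_eq (has_rdiffD Xx (Hphi i) (Hpsi i)) _ _.
  by move=> y; rewrite linearD.
by move=> v; rewrite linearD.
Qed.

Lemma variety_morphismP X Y phi : (forall x, X x -> Y (phi x)) ->
  (forall x, X x -> exists dphi, has_vdiff X phi x dphi) ->
  variety_morphism X Y phi.
Proof.
move=> XY Hphi; split=> // U oU; split.
  (* The union of all open sets whose trace on [X] is mapped into [U]. *)
  exists [set x | exists2 O : set V, zopen O /\ O x &
    forall y, X y -> O y -> U (phi y)]%classic.
    apply: zopen_locally => x [O [oO Ox] OU].
    have [p [px pO]] := zopen_basis oO Ox.
    exists p; split=> // y py; exists O => //; split=> //; exact: pO.
  apply/seteqP; split=> x [Xx] /=.
    have [dphi Hx] := Hphi x Xx.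
    by move=> /(preimage_locally Xx Hx oU)[O [oO Ox OU]]; split=> //; exists O.
  by case=> O [oO Ox] OU; split=> //; apply: OU.
move=> f rf x Xx Ux; have [pq rpq] := rf _ (XY _ Xx) Ux.
have [dphi Hx] := Hphi x Xx; have [df Hf _] := regular_rdiff rpq.
by have [pq' ? _] := has_rdiff_comp Xx XY Hx Hf; exists pq'.
Qed.

End Maps.

Section LinearMaps.
Variables (K : fieldType) (V W W' : vectType K).

Lemma has_vdiff_id (X : set V) x : has_vdiff X id x id.
Proof.
move=> i; apply: has_rdiff_eq (has_rdiff_poly X (mpolyX _ (mnm1 i)) x) _ _ => y.
  exact: pevalX.
exact: pdiffX.
Qed.

Lemma has_vdiff_linear (X : set V) (phi : V -> W) x dphi (f : W -> W') : X x ->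
  linear f -> has_vdiff X phi x dphi ->
  has_vdiff X (fun y => f (phi y)) x (fun v => f (dphi v)).
Proof.
move=> Xx lf Hphi i.
apply: (has_rdiff_scalar (l := fun w => coord _ i (f w)) Xx _ Hphi) => a u v.
by rewrite lf linearP.
Qed.

Lemma has_vdiff_comp (X : set V) (Y : set W) (phi : V -> W) x dphi
  (psi : W -> W') dpsi : X x -> (forall y, X y -> Y (phi y)) ->
  has_vdiff X phi x dphi -> has_vdiff Y psi (phi x) dpsi ->
  has_vdiff X (fun y => psi (phi y)) x (fun v => dpsi (dphi v)).
Proof. by move=> Xx XY Hphi Hpsi i; apply: has_rdiff_comp Xx XY Hphi (Hpsi i). Qed.

End LinearMaps.

Section Lines.
Variables (K : numFieldType) (V : vectType K).
Implicit Types (p : polyOn V) (X : set V) (x v : V).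

Lemma peval_line p x v : exists c : {poly K},
  (forall t, c.[t] = peval p (x + t *: v)) /\ c^`().[0] = pdiff p x v.
Proof.
elim/polyOn_ind: p => [a|i|p q [c [cE dc]] [d [dE dd]]|p q [c [cE dc]] [d [dE dd]]].
- by exists a%:P; split=> [t|]; rewrite ?hornerC ?pevalC ?derivC ?hornerC ?pdiffC.
- set l := coord (vbasis (fullv : {vspace V})) i.
  exists ((l x)%:P + l v *: 'X); split=> [t|].
    by rewrite pevalX linearD linearZ !hornerE mulrC.
  by rewrite pdiffX !derivE !hornerE.
- exists (c + d); split=> [t|]; first by rewrite hornerD cE dE pevalD.
  by rewrite derivD hornerD dc dd pdiffD.
- exists (c * d); split=> [t|]; first by rewrite hornerM cE dE pevalM.
  by rewrite derivM hornerD !hornerM dc dd cE dE scale0r addr0 pdiffM.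
Qed.

Lemma poly_eq0_fun (c : {poly K}) : (forall t, c.[t] = 0) -> c = 0.
Proof.
move=> c0; apply/eqP; apply: contraT => cn0.
pose s := [seq i%:R : K | i <- iota 0 (size c)].
have us : uniq s.
  rewrite map_inj_uniq ?iota_uniq// => i j /eqP.
  by rewrite eqr_nat => /eqP.
have := max_poly_roots cn0 _ us; rewrite size_map size_iota ltnn; apply.
by apply/allP => t _; rewrite rootE c0.
Qed.

(** A polynomial vanishing on [X] restricts to the line as a univariate polynomial that is zero
    everywhere, hence zero since the field is infinite; its derivative at 0 is [pdiff]. *)
Lemma tangent_line X x v : (forall t, X (x + t *: v)) -> tangent X x v.
Proof.
move=> Xl p p0; have [c [cE <-]] := peval_line p x v.
have -> : c = 0 by apply: poly_eq0_fun => t; rewrite cE p0.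
by rewrite deriv0 horner0.
Qed.

Lemma tangent_setT x v : tangent setT x v.
Proof. exact: tangent_line. Qed.

End Lines.

(** * Differentials of matrix products, determinants and inverses *)

Section Matrices.
Variables (K : fieldType) (V : vectType K) (X : set V) (x : V) (Xx : X x).

(** Matrix entries and coordinates in the abstract basis [vbasis fullv] are linear combinations of
    each other. *)
Lemma has_vdiff_mxP m n (A dA : V -> 'M[K]_(m, n)) :
  has_vdiff X A x dA <->
  forall i j, has_rdiff X (fun y => A y i j) x (fun v => dA v i j).
Proof.
split=> [HA i j|HA k].
  by apply: (has_rdiff_scalar (l := fun B : 'M_(m, n) => B i j) Xx _ HA) => a B D;
    rewrite !mxE.
set e := coord _ k.
have eE (B : 'M[K]_(m, n)) : \sum_i \sum_j B i j * e (delta_mx i j) = e B.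
  rewrite /e [in RHS](matrix_sum_delta B) linear_sum; apply: eq_bigr => i _.
  by rewrite linear_sum; apply: eq_bigr => j _; rewrite linearZ.
have H i j (_ : true) :=
  has_rdiffM Xx (HA i j) (has_rdiff_cst X (e (delta_mx i j)) x).
have H1 i (_ : true) := has_rdiff_sum (index_enum _) (P := xpredT) Xx (H i).
have Hs := has_rdiff_sum (index_enum _) (P := xpredT) Xx H1.
apply: has_rdiff_eq Hs (fun y => eE (A y)) _ => v.
rewrite -eE; apply: eq_bigr => i _; apply: eq_bigr => j _.
by rewrite mulr0 addr0.
Qed.

Lemma has_vdiff_mulmx m n p (A dA : V -> 'M[K]_(m, n))
    (B dB : V -> 'M[K]_(n, p)) :
  has_vdiff X A x dA -> has_vdiff X B x dB ->
  has_vdiff X (fun y => A y *m B y) x (fun v => dA v *m B x + A x *m dB v).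
Proof.
move=> /has_vdiff_mxP HA /has_vdiff_mxP HB; apply/has_vdiff_mxP => i j.
have H k (_ : true) := has_rdiffM Xx (HA i k) (HB k j).
have Hs := has_rdiff_sum (index_enum _) (P := xpredT) Xx H.
apply: has_rdiff_eq Hs _ _ => y; first by rewrite mxE.
by rewrite !mxE -big_split.
Qed.

Lemma has_rdiff_prod (I : Type) (r : seq I) (F : I -> V -> K) :
  (forall i, exists df, has_rdiff X (F i) x df) ->
  exists df, has_rdiff X (fun y => \prod_(i <- r) F i y) x df.
Proof.
move=> HF; elim: r => [|i r [df IH]].
  exists (fun=> 0); apply: has_rdiff_eq (has_rdiff_cst X 1 x) _ _ => // y.
  by rewrite big_nil.
have [di Hi] := HF i; eexists.
by apply: has_rdiff_eq (has_rdiffM Xx Hi IH) _ _ => y; rewrite ?big_cons.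
Qed.

Lemma has_rdiff_det n (A : V -> 'M[K]_n) :
  (forall i j, exists d, has_rdiff X (fun y => A y i j) x d) ->
  exists d, has_rdiff X (fun y => \det (A y)) x d.
Proof.
move=> HA.
have H (s : 'S_n) : exists d,
    has_rdiff X (fun y => (-1) ^+ s * \prod_i A y i (s i)) x d.
  have [d Hd] := has_rdiff_prod (index_enum _) (fun i => HA i (s i)).
  by eexists; apply: has_rdiffM Xx (has_rdiff_cst _ _ _) Hd.
have [d Hd] := choice H.
have := has_rdiff_sum (index_enum _) (P := xpredT) Xx (fun s _ => Hd s).
by eexists; eassumption.
Qed.

End Matrices.

Section Inverse.
Variables (K : numFieldType) (n : nat).
Implicit Types a : 'M[K]_n.

(** The cofactor formula shows that some differential exists; differentiating [b *m invmx b = 1%:M]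
    determines its value. *)
Lemma has_vdiff_invmx a : a \in unitmx ->
  has_vdiff setT (@invmx K n) a (fun v => - (invmx a *m v *m invmx a)).
Proof.
move=> ua; have T : [set: 'M[K]_n]%classic a by [].
have Hid i j := iffLR (has_vdiff_mxP T _ _) (has_vdiff_id setT a) i j.
have [dd Hdet] := has_rdiff_det T (fun i j => ex_intro _ _ (Hid i j)).
have det0 : \det a != 0 by rewrite -unitfE -unitmxE.
have Hdi := has_rdiffV (f := fun b : 'M[K]_n => \det b) T det0 Hdet.
(* Both the cofactor formula and the identity for the inverse hold on invertible matrices only, so a
   basic neighbourhood of [a] inside [unitmx] is extracted from the germ of the determinant. *)
have [u [ua0 uU]] : exists p : polyOn 'M[K]_n, peval p a != 0 /\
    forall b, peval p b != 0 -> b \in unitmx.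
  have [[p q] [U [oU Ua Upq]] _] := Hdet.
  have [w [wa wU]] := zopen_basis oU Ua.
  have [/= qa da] := Upq a I Ua.
  exists (w * p); rewrite pevalM; split.
    by rewrite mulf_neq0//; apply: contra_neq det0 => p0; rewrite da p0 mul0r.
  move=> b; rewrite pevalM mulf_eq0 negb_or => /andP[/wU Ub pb].
  have [/= qb db] := Upq b I Ub.
  by rewrite unitmxE unitfE db mulf_neq0// invr_eq0.
have oU := zopen_neq0 u.
have [d Hd] : exists d, has_vdiff setT (@invmx K n) a d.
  have Hadj i j : exists d, has_rdiff setT (fun b : 'M[K]_n => \adj b i j) a d.
    have Hm i' j' : exists d,
        has_rdiff setT (fun b : 'M[K]_n => (row' j (col' i b)) i' j') a d.
      exists (fun v : 'M[K]_n => v (lift j i') (lift i j')).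
      apply: has_rdiff_eq (Hid (lift j i') (lift i j')) _ _ => // b.
      by rewrite !mxE.
    have [d Hd] := has_rdiff_det T Hm; eexists.
    have := has_rdiffM T (has_rdiff_cst setT ((-1) ^+ (j + i)) a) Hd.
    by move/has_rdiff_eq; apply=> // b; rewrite /adjugate mxE.
  have /choice[d Hd] : forall ij : 'I_n * 'I_n, exists d,
      has_rdiff setT (fun b : 'M[K]_n => (invmx b) ij.1 ij.2) a d.
    move=> [i j]; have [d Hd] := Hadj i j; eexists.
    apply: (has_rdiff_local oU ua0) (has_rdiffM T Hdi Hd) => b _ /uU ub.
    by rewrite /invmx ub !mxE.
  exists (fun v => \matrix_(i, j) d (i, j) v); apply/has_vdiff_mxP => // i j.
  by apply: has_rdiff_eq (Hd (i, j)) _ _ => // v; rewrite mxE.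
have H1 := has_vdiff_mulmx T (has_vdiff_id setT a) Hd.
have H2 : has_vdiff setT (fun b : 'M[K]_n => b *m invmx b) a (fun=> 0).
  move=> i.
  apply: (has_rdiff_local oU ua0) (has_vdiff_cst setT 1%:M a i) => b _ /uU ub.
  by rewrite mulmxV.
apply: has_vdiff_eq Hd _ _ => // v.
have := has_vdiff_unique T (tangent_setT a v) H1 H2 => /eqP.
rewrite addrC addr_eq0 => /eqP/(congr1 (mulmx (invmx a))).
by rewrite mulKmx// mulmxN mulmxA.
Qed.

End Inverse.

(** * The group, its Lie algebra and the map Phi *)

Section Group.
Variables (K : numFieldType) (n : nat) (G : set 'M[K]_n).
Hypothesis G_alg : linear_algebraic_group G.
Local Notation g := (lieAlg G).
Implicit Types (a b : 'M[K]_n) (x y z : g).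

Lemma group_unit a : G a -> a \in unitmx.
Proof. by case: G_alg => _ _ _ [Z _ ->] []. Qed.

Lemma LieE u : u \in Lie G <-> tangent G 1%:M u.
Proof. exact: LieP. Qed.

(** Right translation by [a] is linear and preserves [G], so it is its own differential and carries
    tangent vectors at 1 to tangent vectors at [a]. *)
Lemma tangent_mulr a u : G a -> u \in Lie G -> tangent G a (u *m a).
Proof.
case: G_alg => G1 GM _ _ Ga /LieE Tu; rewrite -[X in tangent G X]mul1mx.
apply: (tangent_image (phi := mulmx^~ a) (dphi := mulmx^~ a) G1 _ _ Tu).
  by move=> b Gb; apply: GM.
apply: (has_vdiff_linear (f := mulmx^~ a) G1 _ (has_vdiff_id G 1%:M)) => c u1 u2.
by rewrite mulmxDl -scalemxAl.
Qed.

Lemma tangent_mull a u : G a -> u \in Lie G -> tangent G a (a *m u).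
Proof.
case: G_alg => G1 GM _ _ Ga /LieE Tu; rewrite -[X in tangent G X]mulmx1.
apply: (tangent_image (phi := mulmx a) (dphi := mulmx a) G1 _ _ Tu).
  by move=> b Gb; apply: GM.
apply: (has_vdiff_linear (f := mulmx a) G1 _ (has_vdiff_id G 1%:M)) => c u1 u2.
by rewrite linearP.
Qed.

Lemma Lie_conj a u : G a -> u \in Lie G -> a *m u *m invmx a \in Lie G.
Proof.
move=> Ga /(tangent_mull Ga) Tu; apply/LieE; case: G_alg => _ GM GV _.
rewrite -(mulmxV (group_unit Ga)).
apply: (tangent_image (phi := mulmx^~ (invmx a)) (dphi := mulmx^~ (invmx a))
  Ga _ _ Tu).
  by move=> b Gb; apply/GM/GV.
apply: (has_vdiff_linear (f := mulmx^~ (invmx a)) Ga _ (has_vdiff_id G a)).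
move=> c u1 u2.
by rewrite mulmxDl -scalemxAl.
Qed.

(* For [p] vanishing on [G], [b |-> d p_b (b u)] vanishes on [G] as well; its
   derivative at 1 along [v] is [D^2 p (v, u) + d p (v u)], and the second
   derivative is symmetric. *)
Lemma Lie_bracket u v : u \in Lie G -> v \in Lie G ->
  u *m v - v *m u \in Lie G.
Proof.
case: G_alg => G1 _ _ _; move=> uL vL; apply/LieE => p p0.
pose crd := coord (vbasis (fullv : {vspace 'M[K]_n})).
pose D2 v w := \sum_i pdiff (mderiv i p) 1%:M v * crd i w.
have D2C w t : D2 w t = D2 t w.
  rewrite /D2 /pdiff; under eq_bigr do rewrite mulr_suml.
  rewrite exchange_big; apply: eq_bigr => i _; rewrite mulr_suml.
  by apply: eq_bigr => j _; rewrite mderiv_comm mulrAC.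
have H w t : w \in Lie G -> t \in Lie G ->
    D2 t w + pdiff p 1%:M (t *m w) = 0.
  move=> wL tL.
  have Hi i (_ : true) : has_rdiff G
      (fun b => peval (mderiv i p) b * crd i (b *m w)) 1%:M
      (fun s => pdiff (mderiv i p) 1%:M s * crd i (1%:M *m w) +
                peval (mderiv i p) 1%:M * crd i (s *m w)).
    apply: (has_rdiffM G1 (has_rdiff_poly _ _ _)).
    apply: (has_rdiff_scalar (l := fun b => crd i (b *m w)) G1 _
      (has_vdiff_id G 1%:M)).
    by move=> c u1 u2; rewrite mulmxDl -scalemxAl /crd linearP.
  have Hs := has_rdiff_sum (index_enum _) (P := xpredT) G1 Hi.
  have /LieE Tt := tL.
  have := rdiff_eq G1 Hs Tt; rewrite big_split /= mul1mx => <-.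
  rewrite (rdiff_eq (df := fun=> 0) G1 _ Tt)//.
  apply: (has_rdiff_local (f := fun=> 0) (zopenT _) I _ (has_rdiff_cst G 0 _)).
  by move=> b Gb _; rewrite -/(pdiff p b (b *m w)) tangent_mull.
(* Comparing the identities for both orders cancels the symmetric [D2] and leaves equal
   differentials along [u *m v] and [v *m u]. *)
have := etrans (H v u vL uL) (esym (H u v uL vL)); rewrite D2C => /addrI e.
have -> : u *m v - v *m u = (-1) *: (v *m u) + u *m v.
  by rewrite scaleN1r addrC.
by rewrite pdiffP e mulN1r addNr.
Qed.

Lemma brkE x y :
  vsval (brk x y) = vsval x *m vsval y - vsval y *m vsval x.
Proof. by rewrite vsprojK// Lie_bracket// subvsP. Qed.

Lemma AdE a x : G a -> vsval (Ad a x) = a *m vsval x *m invmx a.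
Proof. by move=> Ga; rewrite vsprojK// Lie_conj// subvsP. Qed.

Lemma brk_jacobi x y z : brk x (brk y z) = brk (brk x y) z + brk y (brk x z).
Proof.
apply: subvs_inj; rewrite [RHS]linearD /= !brkE.
rewrite !(mulmxBr, mulmxBl) !mulmxA.
move: (_ *m _ *m _) (_ *m _ *m _) (_ *m _ *m _) (_ *m _ *m _) (_ *m _ *m _)
  (_ *m _ *m _) => A1 A2 A3 A4 A5 A6.
by apply/matrixP => i j; rewrite !mxE; ring.
Qed.

Fact Ad_linear a : linear (@Ad K n G a).
Proof.
move=> c x y; rewrite /Ad -linearP /=; congr (vsproj _ _).
by rewrite mulmxDr mulmxDl -scalemxAr -scalemxAl.
Qed.
HB.instance Definition _ a :=
  GRing.isLinear.Build K g g *:%R (@Ad K n G a) (Ad_linear a).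

Lemma Ad_brk a x y : G a -> Ad a (brk x y) = brk (Ad a x) (Ad a y).
Proof.
move=> Ga; have Va := mulVmx (group_unit Ga).
apply: subvs_inj; rewrite AdE// !brkE !AdE// mulmxBr mulmxBl !mulmxA.
by rewrite -!(mulmxA _ (invmx a) a) Va !mulmx1.
Qed.

Lemma AdK a x : G a -> Ad (invmx a) (Ad a x) = x.
Proof.
case: G_alg => _ _ GV _ Ga; have ua := group_unit Ga.
apply: subvs_inj; rewrite !AdE//; last exact: GV.
by rewrite invmxK !mulmxA mulVmx// mul1mx mulmxKV.
Qed.

Lemma AdVK a x : G a -> Ad a (Ad (invmx a) x) = x.
Proof.
case: G_alg => _ _ GV _ Ga.
by rewrite -[X in Ad X (Ad _ x)]invmxK AdK//; apply: GV.
Qed.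

(** [Ad a] is an automorphism, so [ad (Ad a z)] is conjugate to [ad z], and conjugations cancel in
    the trace. *)
Lemma killing_Ad a x y : G a -> killing (Ad a x) (Ad a y) = killing x y.
Proof.
move=> Ga; pose A : 'End(g) := linfun (Ad a).
pose B : 'End(g) := linfun (Ad (invmx a)).
have BA : (B \o A)%VF = \1%VF.
  by apply/lfunP => z; rewrite comp_lfunE !lfunE /= AdK.
have adAd z : ad (Ad a z) = (A \o ad z \o B)%VF.
  apply/lfunP => w; rewrite !comp_lfunE !adE !lfunE /= Ad_brk//.
  by rewrite AdVK.
rewrite /killing !adAd -!comp_lfunA [(B \o (A \o _))%VF]comp_lfunA BA.
rewrite comp_lfun1l.
by rewrite end_traceC -!comp_lfunA BA comp_lfun1r.
Qed.


Section Slice.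
Variables xi eta : g.
Local Notation M := ('M[K]_n * g)%type.

Lemma GxS_translate a x z : GxS xi eta (a, x) -> z \in centralizer eta ->
  GxS xi eta (a, x + z).
Proof.
move=> [/= Ga [s sC <-]] zC; split=> //=.
by exists (s + z); rewrite ?addrA//=; apply: memvD.
Qed.

(** The [G] component is the image of a translated tangent vector under [b |-> (b, x)]; the slice
    component is the direction of an affine line contained in the slice. *)
Lemma tangent_right_vec (ax : M) w : GxS xi eta ax -> tangent_GxS eta w ->
  tangent (GxS xi eta) ax (right_vec ax.1 w).
Proof.
case: ax w => a x [y z] Xax /= zC; have Ga : G a by case: Xax.
have -> : right_vec a (y, z) = 1 *: (vsval y *m a, 0) + (0, z).
  by rewrite scale1r /right_vec; congr pair; rewrite ?addr0 ?add0r.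
apply: tangentP.
  apply: (tangent_image (X := G) (phi := fun b => (b, x))
    (dphi := fun b => (b, 0)) Ga _ _ (tangent_mulr Ga (subvsP y))).
    by move=> b Gb; split=> //=; case: Xax.
  have lin : linear (fun b : 'M[K]_n => (b, 0) : M).
    by move=> c u v; congr pair; rewrite /= ?scaler0 ?addr0.
  have H := has_vdiff_linear Ga lin (has_vdiff_id G a).
  apply: has_vdiff_eq (has_vdiffD Ga H (has_vdiff_cst G (0, x) a)) _ _ => b.
    by congr pair; rewrite /= ?addr0 ?add0r.
  by rewrite addr0.
apply: tangent_line => t.
have -> : (a, x) + t *: (0, z) = (a, x + t *: z) :> M.
  by congr pair; rewrite /= ?scaler0 ?addr0.
by apply: GxS_translate => //; apply: memvZ.
Qed.

(** The product rule for minus the conjugate of [x] by the inverse of [a], along an arbitrary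
    ambient vector [w]. *)
Definition dPhi (ax w : M) : g :=
  - vsproj (Lie G) ((- (invmx ax.1 *m w.1 *m invmx ax.1) *m vsval ax.2
     + invmx ax.1 *m vsval w.2) *m ax.1 + invmx ax.1 *m vsval ax.2 *m w.1).

Lemma has_vdiff_Phi (ax : M) : GxS xi eta ax ->
  has_vdiff (GxS xi eta) (@Phi _ _ G) ax (dPhi ax).
Proof.
move=> Xax; have Ga : G ax.1 by case: Xax.
have Hid := has_vdiff_id (GxS xi eta) ax.
have H1 : has_vdiff (GxS xi eta) (fun w => w.1) ax (fun w => w.1).
  by apply: (has_vdiff_linear Xax _ Hid).
have H2 : has_vdiff (GxS xi eta) (fun w => vsval w.2) ax (fun w => vsval w.2).
  apply: (has_vdiff_linear (f := fun w : M => vsval w.2) Xax _ Hid) => c u v.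
  by rewrite linearP.
have HV := has_vdiff_comp (Y := setT) Xax (fun _ _ => I) H1
  (has_vdiff_invmx (group_unit Ga)).
have H3 := has_vdiff_mulmx Xax (has_vdiff_mulmx Xax HV H2) H1.
have lin : linear (fun u => - vsproj (Lie G) u).
  by move=> c u v; rewrite linearP opprD scalerN.
apply: has_vdiff_eq (has_vdiff_linear Xax lin H3) _ _ => // w.
by rewrite /Phi /Ad invmxK.
Qed.

Lemma dPhi_right_vec (ax : M) (w : g * g) : GxS xi eta ax ->
  dPhi ax (right_vec ax.1 w) = - Ad (invmx ax.1) (w.2 + brk ax.2 w.1).
Proof.
move=> [Ga _]; have ua := group_unit Ga; rewrite /dPhi /Ad invmxK.
rewrite [vsval (_ + _)]linearD /=.
rewrite brkE; congr (- vsproj _ _).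
rewrite !(mulmxDr, mulmxDl, mulmxN, mulNmx, mulmxA) mulmxK//.
by rewrite addrAC addrC [- _ + _]addrC addrA.
Qed.

End Slice.
End Group.

(** * Killing gradients and comparison of the two brackets *)

Section Poisson.
Variables (C : numClosedFieldType) (n : nat) (G : set 'M[C]_n).
Hypothesis G_alg : linear_algebraic_group G.
Hypothesis G_ss : lie_semisimple G.
Local Notation g := (lieAlg G).
Implicit Types (a : 'M[C]_n) (x y z : g) (f k : g -> C).

Let killing_nondegenerate := cartan_criterion (brk_jacobi G_alg) G_ss.

Lemma lker_kappa : lker (kappa G) = 0%VS.
Proof.
apply/eqP; rewrite -subv0; apply/subvP => x.
rewrite memv_ker memv0 => /eqP x0; apply/eqP/killing_nondegenerate => y.
by rewrite -kappaE x0 lfunE.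
Qed.

Lemma kappaK : cancel (kappa G) (kappa G)^-1%VF.
Proof. by apply: lker0_lfunK; rewrite lker_kappa. Qed.

Lemma kappaVK : cancel (kappa G)^-1%VF (kappa G).
Proof.
have full : limg (kappa G) = fullv.
  apply/eqP; rewrite eqEdim subvf /= limg_dim_eq.
    by rewrite !dimvf /dim /= muln1.
  by rewrite lker_kappa capv0.
by move=> l; apply: limg_lfunVK; rewrite full memvf.
Qed.

Lemma gradient_exists (l : g -> C) : scalar l ->
  exists u, forall y, l y = killing y u.
Proof.
move=> sl; pose L : dualAlg G := linfun (l : g -> C^o).
exists ((kappa G)^-1%VF L) => y.
by rewrite killingC -kappaE kappaVK lfun_linearE.
Qed.

(** The differential of the transported function at [kappa G x] is evaluation at [u]. Nondegeneracy
    makes such a [u] unique, so [xget] returns it. *)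
Lemma dual_diff_eq f x df u : has_rdiff setT f x df ->
  (forall y, df y = killing y u) ->
  dual_diff (f \o (kappa G)^-1%VF) (kappa G x) = u.
Proof.
move=> Hf dfu.
have dF b : rdiff setT (f \o (kappa G)^-1%VF) (kappa G x) b = b u.
  rewrite (rdiff_eq (df := fun b => df ((kappa G)^-1%VF b)) _ _
    (tangent_setT _ b))//.
    by rewrite dfu -kappaE kappaVK.
  apply: (has_rdiff_comp (Y := setT)) => //; last by rewrite kappaK; exact: Hf.
  apply: (has_vdiff_linear (f := (kappa G)^-1%VF) _ _ (has_vdiff_id _ _)) => //.
  exact: linearP.
apply: xget_unique => [b|v vP]; first by rewrite dF.
apply/eqP; rewrite -subr_eq0; apply/eqP/killing_nondegenerate => y.
by rewrite killingC killingDr killingNr -!kappaE vP dF subrr.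
Qed.

Lemma lie_poissonE f k x df dk u v :
  has_rdiff setT f x df -> (forall y, df y = killing y u) ->
  has_rdiff setT k x dk -> (forall y, dk y = killing y v) ->
  lie_poisson f k x = killing x (brk u v).
Proof.
move=> Hf dfu Hk dkv; rewrite /lie_poisson /lie_poisson_dual.
by rewrite (dual_diff_eq Hf dfu) (dual_diff_eq Hk dkv) kappaE.
Qed.

Lemma omegaC (ax : 'M[C]_n * g) w1 w2 : omega ax w1 w2 = - omega ax w2 w1.
Proof.
by rewrite /omega [brk w1.1 _]brkC killingNr; ring.
Qed.

Section Slice.
Variables xi eta : g.

(* [(- Ad a u, 0)] is a Hamiltonian vector at [ax] of the pull-back by [Phi] of
   any function with Killing gradient [u] at [Phi ax]. *)
Lemma omega_Phi (ax : 'M[C]_n * g) u w : GxS xi eta ax ->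
  omega ax (- Ad ax.1 u, 0) w = killing (dPhi ax (right_vec ax.1 w)) u.
Proof.
move=> Xax; have Ga : G ax.1 by case: Xax.
rewrite (dPhi_right_vec G_alg _ Xax) /omega /=.
rewrite -(killing_Ad G_alg _ u Ga) linearN /= (AdVK G_alg)//.
rewrite !killingNl killing0r subr0 killingDl (killing_brk (brk_jacobi G_alg)).
rewrite [brk (- _) _]brkC [brk _ (- _)]linearN opprK opprD.
by rewrite [killing _ w.2]killingC.
Qed.

(** The vector picked by [xget] is compared with [(- Ad ax.1 u, 0)] through pairings with tangent
    vectors. The latter witnesses existence, so the picked vector satisfies its specification. *)
Lemma hamiltonian_Phi (ax : 'M[C]_n * g) f df u : GxS xi eta ax ->
  has_rdiff setT f (Phi ax) df -> (forall y, df y = killing y u) ->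
  tangent_GxS eta (hamiltonian xi eta (f \o @Phi _ _ G) ax) /\
  forall w, tangent_GxS eta w ->
    omega ax (hamiltonian xi eta (f \o @Phi _ _ G) ax) w =
    omega ax (- Ad ax.1 u, 0) w.
Proof.
move=> Xax Hf dfu.
have dF w : tangent_GxS eta w ->
    rdiff (GxS xi eta) (f \o @Phi _ _ G) ax (right_vec ax.1 w) =
    omega ax (- Ad ax.1 u, 0) w.
  move=> Tw; rewrite omega_Phi// -dfu.
  have HF := has_rdiff_comp (Y := setT) Xax (fun _ _ => I)
    (has_vdiff_Phi G_alg Xax) Hf.
  exact: (rdiff_eq Xax HF (tangent_right_vec G_alg Xax Tw)).
have ex : exists X : g * g, tangent_GxS eta X /\ forall w, tangent_GxS eta w ->
    omega ax X w = rdiff (GxS xi eta) (f \o @Phi _ _ G) ax (right_vec ax.1 w).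
  exists (- Ad ax.1 u, 0); split; first by rewrite /tangent_GxS /= mem0v.
  by move=> w Tw; rewrite dF.
have [TX XP] := xgetPex 0 ex; split=> // w Tw.
by rewrite XP// dF.
Qed.

Lemma slice_poisson_Phi (ax : 'M[C]_n * g) f k df dk u v : GxS xi eta ax ->
  has_rdiff setT f (Phi ax) df -> (forall y, df y = killing y u) ->
  has_rdiff setT k (Phi ax) dk -> (forall y, dk y = killing y v) ->
  slice_poisson xi eta (f \o @Phi _ _ G) (k \o @Phi _ _ G) ax =
  killing (Phi ax) (brk u v).
Proof.
move=> Xax Hf dfu Hk dkv; have Ga : G ax.1 by case: Xax.
have [Tf Pf] := hamiltonian_Phi Xax Hf dfu.
have [Tk Pk] := hamiltonian_Phi Xax Hk dkv.
have T0 y : tangent_GxS eta (y, 0) by rewrite /tangent_GxS /= mem0v.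
(* The chosen Hamiltonian vectors are replaced one at a time in the left slot, antisymmetry
   exchanging the slots; each time the other argument is tangent. *)
rewrite /slice_poisson Pf// omegaC Pk// -omegaC omega_Phi//.
rewrite (dPhi_right_vec G_alg _ Xax) /= add0r [brk _ (- _)]linearN.
have GV : G (invmx ax.1) by case: G_alg => _ _ GV _; apply: GV.
rewrite linearN /= opprK (Ad_brk G_alg)// (AdK G_alg)//.
rewrite (killing_brk (brk_jacobi G_alg)).
by rewrite /Phi killingNl [brk u v]brkC killingNr opprK.
Qed.

(** Differentials of regular germs are linear, so they have Killing gradients [u] and [v]; both
    brackets then equal [killing (Phi ax) (brk u v)]. *)
Lemma Phi_poisson_morphism :
  poisson_morphism (GxS xi eta) (slice_poisson xi eta)
    setT (@lie_poisson _ _ G) (@Phi _ _ G).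
Proof.
split.
  apply: variety_morphismP => // ax Xax; exists (dPhi ax).
  exact: (has_vdiff_Phi G_alg Xax).
move=> U f k oU rf rk ax Xax Ux.
have [pf /regular_rdiff[df Hf sf]] := rf _ I Ux.
have [pk /regular_rdiff[dk Hk sk]] := rk _ I Ux.
have [u dfu] := gradient_exists sf; have [v dkv] := gradient_exists sk.
by rewrite (slice_poisson_Phi Xax Hf dfu Hk dkv) (lie_poissonE Hf dfu Hk dkv).
Qed.

End Slice.
End Poisson.

Theorem proposition8 (R : realType) (n : nat) (G : set 'M[Cplx R]_n)
    (G_alg : linear_algebraic_group G)
    (G_conn : zconnected G)
    (G_sc : simply_connected G)
    (G_ss : lie_semisimple G)
    (xi h eta : lieAlg G)
    (triple : regular_sl2_triple xi h eta) :
  poisson_morphism (GxS xi eta) (slice_poisson xi eta)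
    [set: lieAlg G]%classic (@lie_poisson _ _ G) (@Phi _ _ G).
Proof. exact: Phi_poisson_morphism. Qed.
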